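(* Let $n\ge1$. The one-point compactification $\mathrm{Conf}_n(\mathbb{C}^\times)\cup\{\infty\}$ may be presented as a CW complex whose positive-dimensional cells $e_{(\lambda,i,j)}$, of dimension $n+l(\lambda)-1$, are indexed by triples $(\lambda,i,j)$ where $\lambda=(\lambda_1,\dots,\lambda_{l(\lambda)})$ is an ordered partition (composition) of $n+1$, $i$ is the index of the imaginary axis in the configuration ($1\le i\le l(\lambda)$), i.e. there are $i-1$ vertical columns to the left of the imaginary axis, and $j$ is the number of points with zero real part and negative imaginary part ($0\le j\le\lambda_i-1$). For $1\le m<l(\lambda)$ let $\rho^m=(\lambda_1,\dots,\lambda_m+\lambda_{m+1},\dots,\lambda_{l(\lambda)})$ be the coarsening of $\lambda$ obtained by summing $\lambda_m$ and $\lambda_{m+1}$. The codimension-$1$ boundary cells of $e_{(\lambda,i,j)}$ have the four general forms: (1) $e_{(\rho^m,i-1,j)}$ for $1\le m<i-1$; (2) $e_{(\rho^m,i,j)}$ for $i<m<l(\lambda)$; (3) $e_{(\rho^{i-1},i-1,j+h)}$ for $0\le h\le\lambda_{i-1}$; (4) $e_{(\rho^i,i,j+h)}$ for $0\le h\le\lambda_{i+1}$; where $h$ denotes the number of points going below the origin when the imaginary axis is combined with the neighbouring column on the left (in (3)) or on the right (in (4)).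
   Context: $\mathrm{Conf}_n(X)$ is the space of unordered configurations of $n$ distinct points of $X$; $\mathbb{C}^\times=\mathbb{C}\setminus\{0\}$. $l(\lambda)$ is the number of parts of $\lambda$; parts are positive integers. The cell $e_{(\lambda,i,j)}\subset\mathrm{Conf}_n(\mathbb{C}^\times)$ is described as follows. Add the origin $O$ to a configuration of $n$ points in $\mathbb{C}^\times$ to obtain a configuration of $n+1$ points in $\mathbb{C}$. Group these $n+1$ points into vertical columns according to their real parts, ordered from left to right by increasing real part. Then the configuration lies in $e_{(\lambda,i,j)}$ if there are exactly $l(\lambda)$ columns, the $m$-th column contains exactly $\lambda_m$ points, the $i$-th column is the one containing $O$ (i.e. lies on the imaginary axis), and exactly $j$ points of that column lie below $O$. The remaining cell is the $0$-cell $\{\infty\}$. Forms (3) and (4) occur only when $i\ge2$ and $i<l(\lambda)$ respectively.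
   Formalization: The list (1)–(4) is asserted for the boundary cells e_(λ,i,j) only, not for the 0-cell {∞}; this matters only for n=1, where ∞ is a codimension-1 boundary cell of the 1-cells e_((2),1,j) and has none of the four forms. *)

(* Defs.v *)
From HB Require Import structures.
From mathcomp Require Import all_boot all_order all_fingroup all_algebra.
From mathcomp Require Import generic_quotient complex.
From mathcomp Require Import all_classical all_reals all_analysis.

Set Implicit Arguments.
Unset Strict Implicit.
Unset Printing Implicit Defensive.

Import Order.TTheory GRing.Theory Num.Theory.
Import numFieldNormedType.Exports.

Local Open Scope classical_set_scope.
Local Open Scope ring_scope.
Local Open Scope quotient_scope.

Section CWComplex.
Context {R : realType}.

(* The norm of 'rV[R]_k in the library is the sup norm, hence the explicit
   sums of squares. *)
Definition disk k : set 'rV[R]_k := [set x | \sum_i x ord0 i ^+ 2 <= 1].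
Definition open_disk k : set 'rV[R]_k := [set x | \sum_i x ord0 i ^+ 2 < 1].
Definition sphere k : set 'rV[R]_k := [set x | \sum_i x ord0 i ^+ 2 = 1].

End CWComplex.

Arguments disk {R} k.
Arguments open_disk {R} k.
Arguments sphere {R} k.

Definition homeomorphism_on (X Y : topologicalType) (A : set X) (B : set Y)
    (f : X -> Y) : Prop :=
  [/\ set_bij A B f, {within A, continuous f} &
      exists g : Y -> X,
        (forall x, A x -> g (f x) = x) /\ {within B, continuous g}].

Definition characteristic_map (R : realType) (X : topologicalType) (I : Type)
    (dim : I -> nat) (cell : I -> set X) (i : I)
    (Phi : 'rV[R]_(dim i) -> X) : Prop :=
  [/\ {within disk (dim i), continuous Phi},
      homeomorphism_on (open_disk (dim i)) (cell i) Phi &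
      exists J : set I,
        [/\ finite_set J, (forall k, J k -> (dim k < dim i)%N) &
            Phi @` sphere (dim i) `<=` \bigcup_(k in J) cell k]].

Record is_CW_complex (R : realType) (X : topologicalType) (I : Type)
    (dim : I -> nat) (cell : I -> set X) : Prop := IsCWComplex {
  cw_hausdorff : hausdorff_space X;
  cw_cover : \bigcup_i cell i = setT;
  cw_disjoint : forall i k, cell i `&` cell k !=set0 -> i = k;
  cw_characteristic : forall i : I,
    exists Phi : 'rV[R]_(dim i) -> X, characteristic_map cell Phi;
  cw_weak : forall A : set X,
    (forall i, closed (A `&` closure (cell i))) -> closed A }.

Definition codim1_boundary_cell (X : topologicalType) (I : Type)
    (dim : I -> nat) (cell : I -> set X) (a b : I) : Prop :=
  dim a = (dim b).+1 /\
  (closure (cell a) `\` cell a) `&` cell b !=set0.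

Section Configurations.
Context {T : topologicalType} (A : set T) (n : nat).

Definition ordered_config_set : set 'rV[T]_n :=
  [set c : 'rV[T]_n | injective (c ord0) /\ forall k, A (c ord0 k)].

Definition ordered_config : topologicalType := set_type ordered_config_set.

Definition same_config (c d : ordered_config) : bool :=
  [exists s : 'S_n, col_perm s (set_val c) == set_val d].

Lemma same_config_refl : reflexive same_config.
Proof. by move=> c; apply/existsP; exists 1%g; rewrite col_perm1. Qed.

Lemma same_config_sym : symmetric same_config.
Proof.
suff H c d : same_config c d -> same_config d c.
  by move=> c d; apply/idP/idP; exact: H.
case/existsP => s /eqP E; apply/existsP; exists s^-1%g.
by rewrite -E -col_permM mulVg col_perm1.
Qed.

Lemma same_config_trans : transitive same_config.
Proof.
move=> d c e /existsP[s /eqP E] /existsP[t /eqP F]; apply/existsP.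
by exists (t * s)%g; rewrite col_permM E F.
Qed.

Canonical same_config_equiv :=
  EquivRel same_config same_config_refl same_config_sym same_config_trans.

Definition Conf : topologicalType :=
  quotient_topology {eq_quot same_config_equiv}.

Definition config_class (c : ordered_config) : Conf :=
  \pi_{eq_quot same_config_equiv} c.

End Configurations.

Definition C (R : realType) : numFieldType := R[i]%C.

Definition Cstar (R : realType) : set (C R) := [set z | z != 0].

Arguments Cstar R : clear implicits.

Section Columns.
Context {R : realType}.

Definition real_part (z : C R) : R := complex.Re z.
Definition imag_part (z : C R) : R := complex.Im z.

Definition columns (s : seq (C R)) : seq R :=
  sort <=%R (undup (map real_part s)).

Definition column_sizes (s : seq (C R)) : seq nat :=
  [seq count (fun z => real_part z == x) s | x <- columns s].

Definition axis_index (s : seq (C R)) : nat := (index 0 (columns s)).+1.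

Definition num_below_origin (s : seq (C R)) : nat :=
  count (fun z => (real_part z == 0) && (imag_part z < 0)) s.

Definition points_with_origin n (c : ordered_config (Cstar R) n) : seq (C R) :=
  0 :: [seq set_val c ord0 k | k <- enum 'I_n].

End Columns.

(* Triples (lambda, i, j); the index i is 1-based, as is [part]. *)
Definition triple : Type := (seq nat * nat * nat)%type.

Definition part (lam : seq nat) (m : nat) : nat := nth 0%N lam m.-1.

Definition is_composition (N : nat) (lam : seq nat) : bool :=
  all (fun p => 0 < p)%N lam && (sumn lam == N).

Definition is_cell_index (n : nat) (t : triple) : bool :=
  let: (lam, i, j) := t in
  [&& is_composition n.+1 lam, (1 <= i <= size lam)%N &
      (j <= (part lam i).-1)%N].

Definition cell_index (n : nat) : Type := {t : triple | is_cell_index n t}.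

Definition open_cell (R : realType) (n : nat) (t : triple) :
    set (Conf (Cstar R) n) :=
  let: (lam, i, j) := t in
  config_class (A := Cstar R) (n := n) @` [set c |
    [/\ column_sizes (points_with_origin c) = lam,
        axis_index (points_with_origin c) = i &
        num_below_origin (points_with_origin c) = j]].

Arguments open_cell R n t : clear implicits.

Definition Conf_compactified (R : realType) (n : nat) : topologicalType :=
  one_point_compactification (Conf (Cstar R) n).

(* The cells are indexed by [option (cell_index n)], where [None] is the index
   of the 0-cell {oo}. *)
Definition cell_dim (n : nat) (a : option (cell_index n)) : nat :=
  if a is Some t then (n + size (val t).1.1 - 1)%N else 0%N.

Definition cell_set (R : realType) (n : nat) (a : option (cell_index n)) :
    set (Conf_compactified R n) :=
  if a is Some t then Some @` open_cell R n (val t) else [set None].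

Arguments cell_dim n a : clear implicits.
Arguments cell_set R n a : clear implicits.

(* The coarsening rho^m, adding up the parts of 1-based indices m and m+1. *)
Definition coarsening (lam : seq nat) (m : nat) : seq nat :=
  take m.-1 lam ++ (part lam m + part lam m.+1)%N :: drop m.+1 lam.

Inductive boundary_form : triple -> triple -> Prop :=
| Form1 lam i j m : (1 <= m < i.-1)%N ->
    boundary_form (lam, i, j) (coarsening lam m, i.-1, j)
| Form2 lam i j m : (i < m < size lam)%N ->
    boundary_form (lam, i, j) (coarsening lam m, i, j)
| Form3 lam i j h : (2 <= i)%N -> (h <= part lam i.-1)%N ->
    boundary_form (lam, i, j) (coarsening lam i.-1, i.-1, (j + h)%N)
| Form4 lam i j h : (i < size lam)%N -> (h <= part lam i.+1)%N ->
    boundary_form (lam, i, j) (coarsening lam i, i, (j + h)%N).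

(* Main.v *)
Require Import Defs.
From HB Require Import structures.
From mathcomp Require Import all_boot all_order all_fingroup all_algebra.
From mathcomp Require Import generic_quotient complex.
From mathcomp Require Import all_classical all_reals all_analysis.
From mathcomp Require Import zify ring lra.

(** Sort the n points of a configuration together with the origin by real part,
    then by imaginary part, into a chain z_0 < ... < z_n.  Along the cell
    indexed by (lambda, i, j), the column of z_p depends only on p and lambda,
    and the origin is always z_(p0), where p0 is the offset j in the column i.
    The chain is therefore determined by the gaps between consecutive
    abscissas, which are positive, and the gaps between the ordinates of
    z_q and z_(q+1), which are positive inside a column and arbitrary
    across columns.  There are size lambda - 1 gaps of the first kind and n of
    the second, which accounts for the dimension, and they can be prescribed
    freely: the cell is a product of half-lines and lines.

    Each half-line is compactified to [0, oo], each line to [-oo, oo], and both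
    are identified with [-1, 1] ([gap]).  Thus a point of the closed cube still
    describes a chain, unless one of its gaps is infinite.  It is sent to the
    configuration of this chain, and to the point at infinity if some gap is
    infinite or if two points of the chain collide ([cell_map]).  This map is
    continuous ([cell_map_continuous]): the neighbourhoods of infinity contain
    all configurations in which some point is far enough away or some two
    points, the origin included, are close enough ([conf_of_continuous],
    [conf_of_near_None]).  On the boundary of the cube, a finite gap that
    degenerates either makes two points collide or puts two columns on the same
    vertical line, and then the image lies in a cell with fewer columns
    ([cell_map_sphere]).  A radial homeomorphism from the ball to the cube turns
    [cell_map] into a characteristic map; the continuity of its inverse on the
    open cell follows from compactness ([characteristic_map_of_cube]), once the
    compactification is known to be Hausdorff ([compactified_hausdorff]).

    The boundary statement becomes combinatorial.  The closure of a cell is the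
    image of the closed cube, so a configuration belongs to it exactly when it
    has a layout in columns of the sizes lambda whose abscissas increase only
    weakly ([closure_cellP]).  In codimension 1 exactly two neighbouring
    abscissas coincide.  Merging the two columns gives one of the four boundary
    forms, according to the position of the axis ([merge_layout]).  Conversely
    a column of a configuration in a cell of one of these forms can be split
    into two columns of the required sizes; if it contains the origin,
    the points below and above the origin are distributed so that j of those
    below stay on the axis and h leave it ([split_layout]).  This works for
    every configuration of the smaller cell, which is why the whole cell lies in
    the closure. *)

Set Implicit Arguments.
Unset Strict Implicit.
Unset Printing Implicit Defensive.

Import Order.TTheory GRing.Theory Num.Theory.
Import numFieldNormedType.Exports.

Local Open Scope classical_set_scope.
Local Open Scope ring_scope.
Local Open Scope quotient_scope.

(** * The complex plane *)

Section ComplexPlane.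
Context {R : realType}.

Definition normsq (z : C R) : R := real_part z ^+ 2 + imag_part z ^+ 2.

Lemma sqr_lt_norm (a b e : R) : 0 < e -> a ^+ 2 + b ^+ 2 < e ^+ 2 -> `|a| < e.
Proof.
move=> e0 h; have hb := sqr_ge0 b.
have : `|a| ^+ 2 < e ^+ 2 by rewrite real_normK ?num_real//; lra.
by rewrite ltr_sqr// nnegrE ltW.
Qed.

Definition mkC (x y : R) : C R := (x +i* y)%C.

Lemma normE (z : C R) : `|z| = ((Num.sqrt (normsq z))%:C%C : C R).
Proof. by case: z. Qed.

#[local] Instance nbhs_C_filter (z : C R) : Filter (nbhs z) := nbhs_filter z.

Lemma nbhs_C_dist (z : C R) (e : R) : 0 < e ->
  \forall w \near z, normsq (z - w) < e.
Proof.
move=> e0.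
have e0' : 0 < ((Num.sqrt e)%:C%C : C R) by rewrite ltcR sqrtr_gt0.
have := @cvgr_dist_lt _ (C R) _ _ (nbhs_C_filter z) id z (fun A h => h) _ e0'.
by apply: filterS => w /=; rewrite normE ltcR ltr_sqrt.
Qed.

Lemma real_part_continuous : continuous (@real_part R).
Proof.
move=> z; apply/cvgrPdist_lt => e e0.
have := nbhs_C_dist z (exprn_gt0 2 e0).
apply: filterS => w.
by rewrite /normsq /real_part !raddfB /=; exact: sqr_lt_norm.
Qed.

Lemma imag_part_continuous : continuous (@imag_part R).
Proof.
move=> z; apply/cvgrPdist_lt => e e0.
have := nbhs_C_dist z (exprn_gt0 2 e0).
apply: filterS => w.
by rewrite /normsq /imag_part !raddfB /= addrC; exact: sqr_lt_norm.
Qed.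

Lemma cvg_mkC (T : Type) (F : set_system T) (FF : Filter F) (f g : T -> R) x y :
  f @ F --> x -> g @ F --> y -> (fun t => mkC (f t) (g t)) @ F --> mkC x y.
Proof.
move=> fx gy; apply/(@cvgrPdist_lt _ (C R)) => e e0.
have [r r0 ->] : exists2 r : R, 0 < r & e = (r%:C%C : C R).
  case: e e0 => a b; rewrite ltcE /= => /andP[/eqP -> a0].
  by exists a.
near=> t.
have h1 : `|x - f t| < r / 2.
  by near: t; move/cvgrPdist_lt : fx; apply; rewrite divr_gt0.
have h2 : `|y - g t| < r / 2.
  by near: t; move/cvgrPdist_lt : gy; apply; rewrite divr_gt0.
rewrite normE ltcR -(gtr0_norm r0) -sqrtr_sqr ltr_sqrt ?exprn_gt0//.
rewrite /normsq /real_part /imag_part !raddfB /=.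
move: h1 h2; rewrite !ltr_norml => /andP[? ?] /andP[? ?].
nra.
Unshelve. all: by end_near. Qed.

Lemma normsq_ge0 (z : C R) : 0 <= normsq z.
Proof. by rewrite addr_ge0 ?sqr_ge0. Qed.

Lemma normsq_eq0 (z : C R) : (normsq z == 0) = (z == 0).
Proof.
case: z => x y; rewrite /normsq /real_part /imag_part /=.
by rewrite paddr_eq0 ?sqr_ge0// !sqrf_eq0 eq_complex.
Qed.

Lemma normsq_continuous : continuous normsq.
Proof.
move=> z; rewrite /normsq; apply: cvgD; under eq_cvg do rewrite expr2.
  by rewrite expr2; apply: cvgM; exact: real_part_continuous.
by rewrite expr2; apply: cvgM; exact: imag_part_continuous.
Qed.

(** The order in which the points of a configuration are enumerated. *)
Definition lexlt (z w : C R) : bool :=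
  (real_part z < real_part w) ||
  ((real_part z == real_part w) && (imag_part z < imag_part w)).

Lemma lexlt_trans : transitive lexlt.
Proof.
move=> y x z /orP[xy|/andP[/eqP xy xy']] /orP[yz|/andP[/eqP yz yz']]; apply/orP.
- by left; exact: lt_trans xy yz.
- by left; rewrite -yz.
- by left; rewrite xy.
by right; rewrite xy yz eqxx (lt_trans xy').
Qed.

Lemma lexlt_irr : irreflexive lexlt.
Proof. by move=> z; rewrite /lexlt !ltxx andbF. Qed.

End ComplexPlane.

(** * Ordered configurations and their energy *)

Lemma cvg_sumR (R : realType) (T : topologicalType) (x : T) (I : finType)
    (f : I -> T -> R) (a : I -> R) :
  (forall i, f i @ x --> a i) ->
  (fun t => \sum_i f i t) @ x --> \sum_i a i.
Proof. by move=> fa; apply: cvg_big => // *; exact: add_continuous. Qed.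

Lemma cvg_prodR (R : realType) (T : topologicalType) (x : T) (I : finType)
    (f : I -> T -> R) (a : I -> R) :
  (forall i, f i @ x --> a i) ->
  (fun t => \prod_i f i t) @ x --> \prod_i a i.
Proof. by move=> fa; apply: cvg_big => // *; exact: mul_continuous. Qed.

Lemma cvgD_at (R : realType) (T : topologicalType) (x : T) (f g : T -> R) a b :
  f @ x --> a -> g @ x --> b -> (fun t => f t + g t) @ x --> a + b.
Proof. by move=> fa gb; apply: cvgD. Qed.

Lemma cvgV_at (R : realType) (T : topologicalType) (x : T) (f : T -> R) a :
  a != 0 -> f @ x --> a -> (fun t => (f t)^-1) @ x --> a^-1.
Proof. by move=> a0 fa; apply: cvgV. Qed.

Section Configurations.
Context {R : realType} (n : nat).
Implicit Types (v : 'rV[C R]_n).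

Notation good := (ordered_config_set (Cstar R) (n := n)).

Lemma coordC_continuous (k : 'I_n) : continuous (fun v => v ord0 k : C R).
Proof. exact: coord_continuous. Qed.

Lemma coordC_sub_continuous (k l : 'I_n) :
  continuous (fun v => v ord0 k - v ord0 l : C R).
Proof.
move=> v; apply: (@cvgB _ (C R) _ (nbhs v) (nbhs_filter v)); exact: coord_continuous.
Qed.

Lemma normsq_coord_continuous (k : 'I_n) :
  continuous (fun v => normsq (v ord0 k)).
Proof.
move=> v; apply: (@continuous_comp _ (C R) _ (fun v => v ord0 k) normsq).
  exact: coordC_continuous.
exact: normsq_continuous.
Qed.

Lemma normsq_sub_continuous (k l : 'I_n) :
  continuous (fun v => normsq (v ord0 k - v ord0 l)).
Proof.
move=> v.
apply: (@continuous_comp _ (C R) _ (fun v => v ord0 k - v ord0 l) normsq).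
  exact: coordC_sub_continuous.
exact: normsq_continuous.
Qed.

Lemma cvg_row (T : topologicalType) (x : T) (f : 'I_n -> T -> C R) (v : 'I_n -> C R) :
  (forall k, f k @ x --> v k) ->
  (fun t => \row_k f k t : 'rV[C R]_n) @ x --> (\row_k v k : 'rV[C R]_n).
Proof.
move=> fv U [P nP PU].
suff : \forall t \near x, forall k, P ord0 k (f k t).
  apply: (@filterS _ _ (nbhs_filter x)) => t h; apply: PU => a k.
  by rewrite ord1 mxE.
apply: (filter_forall (nbhs_filter x)) => k.
by apply: (fv k); have := nP ord0 k; rewrite mxE.
Qed.

(** A symmetric function that blows up when a point escapes to infinity, when two
    points collide, and when a point reaches the origin.  The terms with
    [k = l] vanish, the inverse of 0 being 0. *)
Definition energy v : R :=
  \sum_k (normsq (v ord0 k) + (normsq (v ord0 k))^-1) +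
  \sum_k \sum_l (normsq (v ord0 k - v ord0 l))^-1.

Lemma energy_perm (s : 'S_n) v : energy (col_perm s v) = energy v.
Proof.
rewrite /energy [in RHS](reindex_perm s)/= [in X in _ = _ + X](reindex_perm s)/=.
congr (_ + _); first by apply: eq_bigr => k _; rewrite !mxE.
apply: eq_bigr => k _; rewrite [in RHS](reindex_perm s)/=.
by apply: eq_bigr => l _; rewrite !mxE.
Qed.

Lemma energy_continuous v : good v -> {for v, continuous energy}.
Proof.
move=> [inj nz]; apply: cvgD_at.
  apply: cvg_sumR => k.
  apply: cvgD_at; first exact: normsq_coord_continuous.
  apply: cvgV_at; last exact: normsq_coord_continuous.
  by rewrite normsq_eq0; exact: nz.
apply: cvg_sumR => k; apply: cvg_sumR => l.
have [->|kl] := eqVneq k l.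
  rewrite [X in X @ v --> _](_ : _ = cst (normsq (v ord0 l - v ord0 l))^-1).
    exact: cst_continuous.
  by apply/funext => w; rewrite /cst !subrr.
apply: cvgV_at; last exact: normsq_sub_continuous.
rewrite normsq_eq0 subr_eq0; apply: contra_neq kl; exact: inj.
Qed.

End Configurations.

(** * The space of configurations *)

Section ConfigurationClasses.
Context {R : realType} (n : nat).
Implicit Types (v : 'rV[C R]_n).

Notation good := (ordered_config_set (Cstar R) (n := n)).
Notation ordconf := (ordered_config (Cstar R) n).
Notation conf := (Conf (Cstar R) n).

Definition ordered_of v (h : good v) : ordconf := exist _ v (mem_set h).

(** Defined on all of C^n, so that its continuity also covers the degeneration
    to the point at infinity. *)
Definition conf_of v : Conf_compactified R n :=
  if pselect (good v) is left h then Some (config_class (ordered_of h))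
  else None.

Lemma good_val (c : ordconf) : good (set_val c).
Proof. exact: set_mem (valP c). Qed.

Lemma conf_of_val (c : ordconf) : conf_of (set_val c) = Some (config_class c).
Proof.
rewrite /conf_of; case: pselect => [h|]; last by case; exact: good_val.
by congr (Some (config_class _)); apply: val_inj.
Qed.

Lemma conf_of_some v q : conf_of v = Some q ->
  exists2 c : ordconf, set_val c = v & q = config_class c.
Proof. by rewrite /conf_of; case: pselect => // h -[<-]; exists (ordered_of h). Qed.

Lemma conf_of_bad v : ~ good v -> conf_of v = None.
Proof. by rewrite /conf_of; case: pselect. Qed.

Lemma config_class_surj (q : conf) : exists c, q = config_class c.
Proof. by exists (repr q); rewrite /config_class [LHS](esym (reprK q)). Qed.

Lemma config_classP (c d : ordconf) :
  config_class c = config_class d <->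
  exists s : 'S_n, col_perm s (set_val c) = set_val d.
Proof.
split=> [/eqmodP /= /existsP[s /eqP]|[s h]]; first by exists s.
by apply/eqmodP => /=; apply/existsP; exists s; apply/eqP.
Qed.

Lemma config_class_continuous : continuous (@config_class (C R) (Cstar R) n).
Proof. exact: pi_continuous. Qed.

Lemma set_val_continuous : continuous (set_val : ordconf -> 'rV[C R]_n).
Proof. exact: initial_continuous. Qed.

(** Continuous symmetric functions descend to the quotient; they are used to
    bound the energy on compact sets and to separate configurations. *)
Lemma lift_continuous (f : 'rV[C R]_n -> R) :
    (forall v, good v -> {for v, continuous f}) ->
    (forall (s : 'S_n) v, f (col_perm s v) = f v) ->
  exists2 F : conf -> R, continuous F &
    forall c, F (config_class c) = f (set_val c).
Proof.
move=> fc fs; pose g (c : ordconf) := f (set_val c).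
have gE c d : config_class c = config_class d -> g c = g d.
  by move=> /config_classP[s h]; rewrite /g -h fs.
exists (g \o repr).
  apply: repr_comp_continuous => [c|c d /eqP h].
    apply: continuous_comp; first exact: set_val_continuous.
    exact/fc/good_val.
  by apply/eqP/gE.
by move=> c /=; apply: gE; rewrite /config_class [LHS]reprK.
Qed.

Lemma ler_sum_term (I : finType) (f : I -> R) i :
  (forall k, 0 <= f k) -> f i <= \sum_k f k.
Proof. by move=> f0; rewrite (bigD1 i)//= lerDl sumr_ge0. Qed.

Lemma energy_terms v k l : [/\ normsq (v ord0 k) <= energy v,
  (normsq (v ord0 k))^-1 <= energy v &
  (normsq (v ord0 k - v ord0 l))^-1 <= energy v].
Proof.
rewrite /energy; have := @normsq_ge0 R; set N := normsq => N0.
pose f k := N (v ord0 k) + (N (v ord0 k))^-1.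
pose g k := \sum_l (N (v ord0 k - v ord0 l))^-1.
have f0 i : 0 <= f i by rewrite addr_ge0 ?invr_ge0.
have g0 i : 0 <= g i by apply: sumr_ge0 => *; rewrite invr_ge0.
have sf : 0 <= \sum_k f k by exact: sumr_ge0.
have sg : 0 <= \sum_k g k by exact: sumr_ge0.
have fk := ler_sum_term k f0; have gk := ler_sum_term k g0.
rewrite -/(f) in fk *; split.
- by apply: le_trans (_ : f k <= _); rewrite ?lerDl ?invr_ge0// (le_trans fk)// lerDl.
- by apply: le_trans (_ : f k <= _); rewrite ?lerDr ?invr_ge0// (le_trans fk)// lerDl.
apply: le_trans (_ : g k <= _); last by rewrite (le_trans gk)// lerDr.
by apply: (ler_sum_term (f := fun l => (N (v ord0 k - v ord0 l))^-1)) => *; rewrite invr_ge0.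
Qed.

(** The energy is continuous on the space of configurations, hence bounded on
    compact sets. *)
Lemma compact_energy_le (K : set conf) : compact K ->
  exists2 M : R, 0 < M & forall c, K (config_class c) -> energy (set_val c) <= M.
Proof.
move=> cK.
have [F Fc FE] := lift_continuous (@energy_continuous R n) (@energy_perm R n).
have : compact (F @` K).
  by apply: continuous_compact => //; exact: continuous_subspaceT.
move=> /compact_bounded[M [_ hM]].
exists (`|M| + 1) => [|c Kc]; first by rewrite ltr_wpDl.
rewrite -FE; apply: le_trans (ler_norm _) _.
apply: (hM (`|M| + 1)); first by rewrite ltr_pwDr ?ler_norm.
by exists (config_class c).
Qed.

(** A neighbourhood of infinity contains the complement of a compact set, and the
    energy is bounded on that compact set. *)
Lemma nbhs_None (U : set (Conf_compactified R n)) :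
  nbhs (None : Conf_compactified R n) U ->
  exists2 M : R, 0 < M & forall v, (good v -> M < energy v) -> U (conf_of v).
Proof.
case=> K [cK _] KU.
have [M M0 hM] := compact_energy_le cK; exists M => // v hv.
apply: KU; have [gv|/conf_of_bad ->] := pselect (good v); last by right.
left; exists (config_class (ordered_of gv)); last first.
  by rewrite -conf_of_val.
by move=> /hM; rewrite leNgt hv.
Qed.

(** Distinctness and avoiding 0 are finitely many strict inequalities between
    continuous functions. *)
Lemma near_good v : good v -> \forall w \near v, good w.
Proof.
move=> [inj nz].
have pos (f : 'rV[C R]_n -> R) : {for v, continuous f} -> 0 < f v ->
    \forall w \near v, 0 < f w.
  move=> fc fv; have : nbhs (f v) [set x | 0 < x].
    by apply: open_nbhs_nbhs; split; [exact: open_gt|].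
  by move=> /fc.
have h1 : \forall w \near v, forall k, 0 < normsq ((w : 'rV[C R]_n) ord0 k).
  apply: (filter_forall (nbhs_filter v)) => k.
  apply: pos; first exact: normsq_coord_continuous.
  by rewrite lt0r normsq_ge0 normsq_eq0 andbT; exact: nz.
have h2 : \forall w \near v, forall k l, k != l ->
    0 < normsq ((w : 'rV[C R]_n) ord0 k - w ord0 l).
  apply: (filter_forall (nbhs_filter v)) => k.
  apply: (filter_forall (nbhs_filter v)) => l.
  have [->|kl] := eqVneq k l; first by apply: nearW => w.
  suff : \forall w \near v, 0 < normsq ((w : 'rV[C R]_n) ord0 k - w ord0 l).
    by apply: filterS.
  apply: pos; first exact: normsq_sub_continuous.
  rewrite lt0r normsq_ge0 normsq_eq0 andbT subr_eq0.
  by apply: contra_neq kl => /inj.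
apply: filterS2 h1 h2 => w nzw injw; split=> [k l e|k].
  apply/eqP/negPn/negP => /injw; rewrite e subrr lt0r.
  by rewrite normsq_eq0 eqxx.
by have := nzw k; rewrite lt0r normsq_eq0 => /andP[].
Qed.

(** Near a degenerate tuple one of the terms of the energy is large, so the
    configurations leave every compact set. *)
Lemma conf_of_continuous : continuous conf_of.
Proof.
move=> v; have [gv|bv] := pselect (good v).
  move=> U; rewrite {1}/conf_of; case: pselect => // h.
  move=> /= /config_class_continuous -[_ [[W oW <-] /= Wv WU]].
  have nW : nbhs v W by exact: open_nbhs_nbhs.
  suff : nbhs v (conf_of @^-1` U) by [].
  apply: filterS2 (near_good gv) nW => w gw Ww.
  have -> : w = set_val (ordered_of gw) by [].
  by rewrite /= conf_of_val; apply: WU.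
move=> U; rewrite conf_of_bad// => /nbhs_None[M M0 hM].
have small (f : 'rV[C R]_n -> R) : {for v, continuous f} -> f v = 0 ->
    \forall w \near v, f w < M^-1.
  move=> fc fv; have : nbhs (f v) [set x | x < M^-1].
    by apply: open_nbhs_nbhs; split; [exact: open_lt|rewrite /= fv invr_gt0].
  by move=> /fc.
have N0 : normsq (0 : C R) = 0 by apply/eqP; rewrite normsq_eq0.
have inv (x : R) : 0 < x -> x < M^-1 -> M < x^-1.
  by move=> x0 xM; rewrite -(invrK M) ltf_pV2 ?posrE ?invr_gt0.
have [[k vk]|nz] := pselect (exists k, v ord0 k = 0).
  have := small _ (@normsq_coord_continuous R n k v); rewrite vk => /(_ N0).
  apply: filterS => w wM; apply: hM => -[_ /(_ k) wk].
  have [_ + _] := energy_terms w k k; apply: lt_le_trans; apply: inv => //.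
  by rewrite lt0r normsq_eq0 normsq_ge0 andbT.
have [[k [l [kl vkl]]]|inj] := pselect (exists k l, k <> l /\ v ord0 k = v ord0 l).
  have := small _ (@normsq_sub_continuous R n k l v); rewrite vkl subrr => /(_ N0).
  apply: filterS => w wM; apply: hM => -[/(_ k l) wi _].
  have [_ _] := energy_terms w k l; apply: lt_le_trans; apply: inv => //.
  rewrite lt0r normsq_eq0 normsq_ge0 andbT subr_eq0.
  by apply/eqP => /wi.
case: bv; split=> [k l vkl|k]; last by apply/eqP => vk; apply: nz; exists k.
by apply: contrapT => kl; apply: inj; exists k, l.
Qed.

Lemma conf_of_near_None (U : set (Conf_compactified R n)) :
  nbhs (None : Conf_compactified R n) U ->
  exists2 M : R, 0 < M &
    forall v, (exists k, M < normsq (v ord0 k)) -> U (conf_of v).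
Proof.
move=> /nbhs_None[M M0 hM]; exists M => // v [k vk]; apply: hM => _.
by apply: lt_le_trans vk _; have [] := energy_terms v k k.
Qed.

End ConfigurationClasses.

(** * The compactification is Hausdorff *)

Section Compactification.
Context {R : realType} (n : nat).
Implicit Types (v : 'rV[C R]_n).

Notation good := (ordered_config_set (Cstar R) (n := n)).
Notation ordconf := (ordered_config (Cstar R) n).
Notation conf := (Conf (Cstar R) n).

Definition points v : seq (C R) := [seq v ord0 k | k <- enum 'I_n].

Lemma size_points v : size (points v) = n.
Proof. by rewrite size_map size_enum_ord. Qed.

Lemma points_uniq v : good v -> uniq (points v).
Proof. by move=> [inj _]; rewrite map_inj_uniq ?enum_uniq. Qed.

Lemma pointsP v z : reflect (exists k, z = v ord0 k) (z \in points v).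
Proof.
apply: (iffP mapP) => [[k _ ->]|[k ->]]; exists k => //.
by rewrite mem_enum.
Qed.

Lemma good_uniq (v : 'rV[C R]_n) :
  good v <-> uniq (0 :: points v).
Proof.
split=> [gv|/= /andP[v0 uv]].
  rewrite /= points_uniq// andbT; apply/pointsP => -[k v0].
  by have := gv.2 k; rewrite -v0 /Cstar /= eqxx.
split=> [k l kl|k].
  have E (a : 'I_n) : nth 0 (points v) a = v ord0 a.
    by rewrite (nth_map a) ?size_enum_ord// nth_ord_enum.
  have := uv => /(uniqP 0)/(_ k l); rewrite !inE size_points !ltn_ord !E.
  by move=> /(_ isT isT kl) ?; exact: val_inj.
by apply: contraNneq v0 => v0; apply/pointsP; exists k.
Qed.

Lemma config_class_perm (c d : ordconf) :
  config_class c = config_class d <->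
  perm_eq (points (set_val c)) (points (set_val d)).
Proof.
rewrite config_classP; split=> [[s <-]|].
  have -> : points (col_perm s (set_val c)) =
      map (fun k => set_val c ord0 k) (map s (enum 'I_n)).
    by rewrite -map_comp; apply: eq_map => k; rewrite /= mxE.
  apply: perm_map; apply: uniq_perm; first exact: enum_uniq.
    by rewrite (map_inj_uniq perm_inj) enum_uniq.
  move=> k; rewrite mem_enum; symmetry; apply/mapP; exists ((s^-1)%g k).
    by rewrite mem_enum.
  by rewrite permKV.
rewrite perm_sym; pose t : n.-tuple (C R) := [tuple set_val c ord0 k | k < n].
have -> : points (set_val c) = t by [].
move=> /tuple_permP[s hs]; exists s; apply/rowP => k; rewrite mxE.
have := congr1 (fun x => nth 0 x k) hs; rewrite /points /=.
rewrite (nth_map k) ?size_enum_ord// (nth_map k) ?size_enum_ord//.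
by rewrite nth_ord_enum tnth_mktuple.
Qed.

(** These functions separate configurations: [distprod z] vanishes exactly on those
    that contain [z]. *)
Definition distprod (z : C R) v : R := \prod_k normsq (z - v ord0 k).

Lemma distprod_eq0 z v : (distprod z v == 0) = (z \in points v).
Proof.
apply/idP/pointsP => [/prodf_eq0[k _]|[k ->]].
  by rewrite normsq_eq0 subr_eq0 => /eqP ->; exists k.
by apply/prodf_eq0; exists k => //; rewrite normsq_eq0 subrr.
Qed.

Lemma distprod_continuous z : continuous (distprod z).
Proof.
move=> v; apply: cvg_prodR => k.
apply: (@continuous_comp _ (C R) _ (fun v => z - v ord0 k) normsq).
  apply: (@cvgB _ (C R) _ (nbhs v) (nbhs_filter v)); last exact: coord_continuous.
  exact: cst_continuous.
exact: normsq_continuous.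
Qed.

Lemma distprod_perm z (s : 'S_n) v : distprod z (col_perm s v) = distprod z v.
Proof.
rewrite /distprod [in RHS](reindex_perm s)/=.
by apply: eq_bigr => k _; rewrite mxE.
Qed.

(** Two configurations with the same values of all the functions [distprod z]
    contain the same points. *)
Lemma conf_hausdorff : hausdorff_space conf.
Proof.
move=> p q clpq.
have sep (F : conf -> R) : continuous F -> F p = F q.
  move=> Fc; apply: (@Rhausdorff R) => A B nA nB.
  by have [x [Ax Bx]] := clpq _ _ (Fc _ _ nA) (Fc _ _ nB); exists (F x).
have [c pE] := config_class_surj p; have [d qE] := config_class_surj q.
rewrite {}pE {}qE in sep *; apply/config_class_perm.
have sub : points (set_val c) =i points (set_val d).
  move=> z; have [F Fc FE] := lift_continuous
    (fun v _ => @distprod_continuous z v) (distprod_perm z).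
  by have := sep _ Fc; rewrite !FE -!distprod_eq0 => ->.
by apply: uniq_perm => //; apply: points_uniq; exact: good_val.
Qed.

(** A set inside the open locus of ordered configurations stays compact in the
    induced topology. *)
Lemma compact_ordered (L : set 'rV[C R]_n) : compact L -> L `<=` good ->
  compact [set c : ordconf | L (set_val c)].
Proof.
move=> cL Lg F FF FL.
have [v [Lv clv]] := cL (set_val @ F) _ FL.
exists (ordered_of (Lg _ Lv)); split=> // A B FA [_ [[W oW <-] /= Wv WB]].
have [_ [[c Ac <-] Wc]] := clv (set_val @` A) W (filterS (@preimage_image _ _ _ _) FA)
   (open_nbhs_nbhs (conj oW Wv)).
by exists c; split => //; exact: WB.
Qed.

Definition boxC (a : R) : set (C R) :=
  [set z | -a <= real_part z <= a /\ -a <= imag_part z <= a].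

Lemma compact_boxC a : compact (boxC a).
Proof.
have -> : boxC a = (fun p => mkC p.1 p.2) @` (`[-a, a] `*` `[-a, a]).
  apply/seteqP; split=> [[x y] [/= hx hy]|z [[x y] [/= hx hy] <-]].
    by exists (x, y) => //; split; rewrite /= in_itv.
  by move: hx hy; rewrite /= !in_itv.
apply: continuous_compact; last by apply: compact_setX; exact: segment_compact.
apply: continuous_subspaceT => p.
by apply: cvg_mkC; [exact: cvg_fst|exact: cvg_snd].
Qed.

(** Closed and bounded conditions, which keep the points away from each other
    and from 0; they are implied by a bound on the energy. *)
Definition tame (M : R) : set 'rV[C R]_n :=
  [set v | forall k, [/\ normsq (v ord0 k) <= M, M^-1 <= normsq (v ord0 k) &
     forall l, l != k -> M^-1 <= normsq (v ord0 k - v ord0 l)]].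

Lemma tame_good M : 0 < M -> tame M `<=` good.
Proof.
move=> M0 v tv; have pos (z : C R) : M^-1 <= normsq z -> z != 0.
  move=> h; rewrite -normsq_eq0 gt_eqF//; apply: lt_le_trans h.
  by rewrite invr_gt0.
split=> [k l kl|k]; last by have [_ /pos] := tv k.
have [_ _ /(_ k) h] := tv l; apply/eqP/negPn/negP => /h /pos.
by rewrite kl subrr eqxx.
Qed.

Lemma compact_tame M : compact (tame M).
Proof.
pose box := [set v : 'rV[C R]_n | forall k, boxC (`|M| + 1) (v ord0 k)].
have cbox : compact box.
  exact: (@rV_compact (C R) n (fun=> boxC _) (fun=> @compact_boxC _)).
apply: subclosed_compact cbox _ => [|v tv k]; last first.
  have [+ _ _] := tv k; set z := v ord0 k; rewrite /normsq => h.
  have hr := sqr_ge0 (real_part z); have hi := sqr_ge0 (imag_part z).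
  have hM := ler_norm M; have hM0 := normr_ge0 M.
  by split; apply/andP; split; nra.
have -> : tame M = \bigcap_k ([set v | normsq (v ord0 k) <= M] `&`
     ([set v | M^-1 <= normsq (v ord0 k)] `&`
      \bigcap_(l in [set l | l != k])
          [set v | M^-1 <= normsq (v ord0 k - v ord0 l)])).
  apply/seteqP; split=> [v tv k _|v tv k]; have := tv k.
    by move=> [? ? ?]; split.
  by case/(_ I) => ? [].
apply: closed_bigI => k _; apply: closedI; last apply: closedI.
- apply: (@preimage_closed _ _ (fun v => normsq (v ord0 k)) [set x | x <= M]).
    by move=> v _; exact: normsq_coord_continuous.
  exact: closed_le.
- apply: (@preimage_closed _ _ (fun v => normsq (v ord0 k)) [set x | M^-1 <= x]).
    by move=> v _; exact: normsq_coord_continuous.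
  exact: closed_ge.
apply: closed_bigI => l _.
apply: (@preimage_closed _ _ (fun v => normsq (v ord0 k - v ord0 l)) [set x | M^-1 <= x]).
  by move=> v _; exact: normsq_sub_continuous.
exact: closed_ge.
Qed.

(** The configurations of energy less than M form an open set contained in the
    compact image of [tame M]. *)
Lemma conf_locally_compact : locally_compact [set: conf].
Proof.
move=> q _; have [c ->] := config_class_surj q.
have [F Fc FE] := lift_continuous (@energy_continuous R n) (@energy_perm R n).
pose M := `|F (config_class c)| + 1.
have M0 : 0 < M by rewrite ltr_pwDr.
pose K := @config_class _ (Cstar R) n @` [set d | tame M (set_val d)].
have cK : compact K.
  apply: continuous_compact.
    by apply: continuous_subspaceT; exact: config_class_continuous.
  by apply: compact_ordered; [exact: compact_tame|exact: tame_good].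
exists K; last by split => //; apply: compact_closed => //; exact: conf_hausdorff.
rewrite withinET.
have : nbhs (F (config_class c)) [set x | x < M].
  apply: open_nbhs_nbhs; split; first exact: open_lt.
  by rewrite /= (le_lt_trans (ler_norm _))// ltrDl.
move=> /Fc; apply: (@filterS _ _ (nbhs_filter (config_class c))) => q' /=.
have [d ->] := config_class_surj q'; rewrite FE => dM.
exists d => // k; have gd := good_val d.
have inv (z : C R) : z != 0 -> (normsq z)^-1 <= energy (set_val d) ->
    M^-1 <= normsq z.
  move=> z0 h; have N0 : 0 < normsq z by rewrite lt0r normsq_ge0 normsq_eq0 z0.
  rewrite -[leRHS]invrK lef_pV2 ?posrE ?invr_gt0//.
  exact: le_trans h (ltW dM).
split=> [||l lk].
- by have [+ _ _] := energy_terms (set_val d) k k; move=> /le_trans; apply; exact: ltW.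
- by have [_ + _] := energy_terms (set_val d) k k; apply: inv; exact: gd.2.
have [_ _] := energy_terms (set_val d) k l; apply: inv.
by rewrite subr_eq0; apply: contra_neq lk => /gd.1.
Qed.

Lemma compactified_hausdorff : hausdorff_space (Conf_compactified R n).
Proof.
exact: one_point_compactification_hausdorff conf_locally_compact conf_hausdorff.
Qed.

End Compactification.

(** * Closed balls and cubes *)

Section DiskCube.
Context {R : realType} (d : nat).
Implicit Types x y u : 'rV[R]_d.

Lemma mx_norm_leP x (a : R) : 0 <= a ->
  reflect (forall i, `|x ord0 i| <= a) (`|x| <= a).
Proof.
move=> a0; rewrite [in X in reflect _ X]/Num.norm /= mx_normrE.
apply: (iffP (bigmax_leP _ _ _ _)) => [[_ h] i|h]; first exact: (h (ord0, i)).
by split=> // -[i j] _ /=; rewrite ord1.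
Qed.

Lemma mx_norm_ltP x (a : R) : 0 < a ->
  reflect (forall i, `|x ord0 i| < a) (`|x| < a).
Proof.
move=> a0; rewrite [in X in reflect _ X]/Num.norm /= mx_normrE.
apply: (iffP (bigmax_ltP _ _ _ _)) => [[_ h] i|h]; first exact: (h (ord0, i)).
by split=> // -[i j] _ /=; rewrite ord1.
Qed.

Lemma mx_norm_coord x (i : 'I_d) : `|x ord0 i| <= `|x|.
Proof. by have /(mx_norm_leP x (normr_ge0 x)) := lexx `|x|; apply. Qed.

Definition sqnorm x : R := \sum_i x ord0 i ^+ 2.

Lemma sqnorm_ge0 x : 0 <= sqnorm x.
Proof. by apply: sumr_ge0 => i _; exact: sqr_ge0. Qed.

Lemma sqnorm_eq0 x : (sqnorm x == 0) = (x == 0).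
Proof.
rewrite psumr_eq0; last by move=> i _; exact: sqr_ge0.
apply/allP/eqP => [h|-> i _]; last by rewrite /= mxE expr0n eqxx.
apply/rowP => i; have := h i (mem_index_enum _).
by rewrite /= mxE sqrf_eq0 => /eqP.
Qed.

Lemma sqnormZ (a : R) x : sqnorm (a *: x) = a ^+ 2 * sqnorm x.
Proof.
by rewrite /sqnorm mulr_sumr; apply: eq_bigr => i _; rewrite mxE exprMn.
Qed.

Lemma sqnorm_continuous : continuous sqnorm.
Proof.
move=> x; apply: cvg_sumR => i.
apply: (@continuous_comp _ _ _ (fun x => x ord0 i) (fun t : R => t ^+ 2)).
  exact: coord_continuous.
exact: exprn_continuous.
Qed.

Definition enorm x : R := Num.sqrt (sqnorm x).

Lemma enorm_continuous : continuous enorm.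
Proof.
move=> x; apply: (@continuous_comp _ _ _ sqnorm Num.sqrt).
  exact: sqnorm_continuous.
exact: sqrt_continuous.
Qed.

Lemma enorm_eq0 x : (enorm x == 0) = (x == 0).
Proof. by rewrite /enorm sqrtr_eq0 -sqnorm_eq0 eq_le sqnorm_ge0 andbT. Qed.

Lemma enorm_ge0 x : 0 <= enorm x. Proof. exact: sqrtr_ge0. Qed.

Lemma enormZ (a : R) x : 0 <= a -> enorm (a *: x) = a * enorm x.
Proof.
by move=> a0; rewrite /enorm sqnormZ sqrtrM ?sqr_ge0// sqrtr_sqr ger0_norm.
Qed.

Lemma enorm0 : enorm 0 = 0. Proof. by apply/eqP; rewrite enorm_eq0. Qed.

(** The radial rescaling that exchanges the Euclidean and the sup norm. *)
Definition disk_to_cube x := (enorm x / `|x|) *: x.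
Definition cube_to_disk x := (`|x| / enorm x) *: x.

Lemma disk_to_cubeK : cancel disk_to_cube cube_to_disk.
Proof.
move=> x; rewrite /cube_to_disk /disk_to_cube.
have [->|x0] := eqVneq x 0; first by rewrite !scaler0.
have n0 : `|x| != 0 by rewrite normr_eq0.
have e0 : enorm x != 0 by rewrite enorm_eq0.
have q0 : 0 <= enorm x / `|x| by rewrite divr_ge0 ?enorm_ge0.
rewrite enormZ// normrZ (ger0_norm q0) scalerA.
by rewrite (_ : _ * _ = 1) ?scale1r//; field; rewrite e0 n0.
Qed.

Lemma cube_to_diskK : cancel cube_to_disk disk_to_cube.
Proof.
move=> x; rewrite /cube_to_disk /disk_to_cube.
have [->|x0] := eqVneq x 0; first by rewrite !scaler0.
have n0 : `|x| != 0 by rewrite normr_eq0.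
have e0 : enorm x != 0 by rewrite enorm_eq0.
have q0 : 0 <= `|x| / enorm x by rewrite divr_ge0 ?enorm_ge0.
rewrite enormZ// normrZ (ger0_norm q0) scalerA.
by rewrite (_ : _ * _ = 1) ?scale1r//; field; rewrite e0 n0.
Qed.

Lemma norm_disk_to_cube x : `|disk_to_cube x| = enorm x.
Proof.
have [->|x0] := eqVneq x 0; first by rewrite /disk_to_cube scaler0 normr0 enorm0.
rewrite normrZ ger0_norm ?divr_ge0 ?enorm_ge0// divfK//.
by rewrite normr_eq0.
Qed.

(** At 0 the formula involves a division by 0; continuity there comes from the
    fact that the norm of the image tends to 0. *)
Lemma disk_to_cube_continuous : continuous disk_to_cube.
Proof.
move=> x; have [->|x0] := eqVneq x 0.
  have /cvgrPdist_lt en := @enorm_continuous (0 : 'rV[R]_d).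
  apply/(@cvgrPdist_lt _ _ _ _ (nbhs_filter (0 : 'rV[R]_d))) => e e0.
  apply: (@filterS _ _ (nbhs_filter _) _ _ _ (en e e0)) => y.
  rewrite {1}/disk_to_cube scaler0 enorm0 !sub0r !normrN norm_disk_to_cube.
  by rewrite ger0_norm ?enorm_ge0.
apply: (@cvgZ _ _ _ (nbhs x) (nbhs_filter x)); last exact: cvg_id.
apply: (@cvgM _ _ (nbhs x) (nbhs_filter x)); first exact: enorm_continuous.
apply: cvgV_at; first by rewrite normr_eq0.
exact: norm_continuous.
Qed.

Lemma open_diskE : open_disk d = [set x | `|disk_to_cube x| < 1].
Proof.
have E x : (enorm x < 1) = (sqnorm x < 1) by rewrite -{1}sqrtr1 ltr_sqrt.
by apply/seteqP; split=> x; rewrite /open_disk /= norm_disk_to_cube E.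
Qed.

Lemma sphereE : sphere d = [set x | `|disk_to_cube x| = 1].
Proof.
apply/seteqP; split=> x; rewrite /sphere /= norm_disk_to_cube /enorm -/(sqnorm x).
  by move=> ->; rewrite sqrtr1.
by move=> h; rewrite -[LHS]sqr_sqrtr ?sqnorm_ge0// h expr1n.
Qed.

Lemma compact_disk : compact (disk d : set 'rV[R]_d).
Proof.
apply: bounded_closed_compact.
  exists 1; split; rewrite ?num_real// => M M1 x; rewrite /disk /= => xD.
  apply/mx_norm_leP => [|i]; first by rewrite ltW// (lt_trans _ M1).
  have : x ord0 i ^+ 2 <= 1.
    by apply: le_trans xD; rewrite (bigD1 i)//= lerDl sumr_ge0// => *; exact: sqr_ge0.
  rewrite -[X in _ <= X](expr1n _ 2) -real_normK ?num_real// ler_sqr ?nnegrE//.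
  by move=> /le_trans; apply; exact: ltW.
apply: (@preimage_closed _ _ sqnorm [set t : R | t <= 1]).
  by move=> x _; exact: sqnorm_continuous.
exact: closed_le.
Qed.

(** A point of the closed cube is approached by its contractions towards the
    centre. *)
Lemma cube_closure (X : topologicalType) (f : 'rV[R]_d -> X) u :
  continuous f -> `|u| <= 1 -> closure (f @` [set x | `|x| < 1]) (f u).
Proof.
move=> fc u1 U /fc /nbhs_ballP[e /= e0 eU].
(* This choice gives both s < e and s < 1. *)
pose s := e / (1 + e).
have s0 : 0 < s by rewrite divr_gt0// addr_gt0.
have se : s < e by rewrite ltr_pdivrMr ?addr_gt0// mulrDr mulr1 ltrDl mulr_gt0.
have s1 : s < 1 by rewrite ltr_pdivrMr ?addr_gt0// mul1r ltrDr.
exists (f ((1 - s) *: u)); split.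
  exists ((1 - s) *: u) => //=; rewrite normrZ ger0_norm ?subr_ge0 ?ltW//.
  by apply: le_lt_trans (_ : 1 - s < 1); [rewrite ler_piMr// subr_ge0 ltW|lra].
apply: eU; rewrite -ball_normE /ball_ /= -{1}[u]scale1r -scalerBl normrZ.
rewrite opprB addrC subrK (gtr0_norm s0); apply: le_lt_trans se.
by rewrite ler_piMr// ltW.
Qed.

End DiskCube.

(** The inverse on the open cell is continuous because the ball is compact, so that
    the map is closed, and because the image of the sphere misses the cell, lying
    in cells of smaller dimension. *)
Lemma characteristic_map_of_cube (R : realType) (X : topologicalType) (I : Type)
    (dim : I -> nat) (cell : I -> set X) (i : I) (Psi : 'rV[R]_(dim i) -> X) :
  hausdorff_space X ->
  (forall k l, cell k `&` cell l !=set0 -> k = l) ->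
  continuous Psi ->
  (forall u v, `|u| < 1 -> `|v| < 1 -> Psi u = Psi v -> u = v) ->
  Psi @` [set u | `|u| < 1] = cell i ->
  (exists J : set I, [/\ finite_set J, (forall k, J k -> (dim k < dim i)%N) &
      Psi @` [set u | `|u| = 1] `<=` \bigcup_(k in J) cell k]) ->
  characteristic_map cell (Psi \o @disk_to_cube R (dim i)).
Proof.
move=> hX disj Pc Pinj Pim [J [Jfin Jdim Jsph]].
set h := @disk_to_cube R (dim i); set F := Psi \o h.
have Fc : continuous F.
  by move=> x; apply: continuous_comp; [exact: disk_to_cube_continuous|exact: Pc].
have FE : F @` open_disk (dim i) = cell i.
  rewrite -Pim open_diskE; apply/seteqP; split=> [_ [x /= x1 <-]|_ [u /= u1 <-]].
    by exists (h x).
  exists (cube_to_disk u); rewrite /= ?cube_to_diskK//.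
  by rewrite /F /h /= cube_to_diskK.
have Finj x y : open_disk (dim i) x -> open_disk (dim i) y -> F x = F y -> x = y.
  rewrite open_diskE => /= x1 y1 /(Pinj _ _ x1 y1); exact/can_inj/disk_to_cubeK.
have Fsph : F @` sphere (dim i) `<=` \bigcup_(k in J) cell k.
  apply: subset_trans Jsph => _ [x + <-]; rewrite sphereE => /= x1.
  by exists (h x).
have inner x : disk (dim i) x -> cell i (F x) -> open_disk (dim i) x.
  move=> xD xi; rewrite /open_disk /= lt_neqAle andbC; apply/andP; split=> //.
  apply/eqP => x1; have [k Jk kx] : (\bigcup_(k in J) cell k) (F x).
    by apply: Fsph; exists x.
  have /disj ki : cell k `&` cell i !=set0 by exists (F x).
  by have := Jdim k Jk; rewrite ki ltnn.
split; first exact: continuous_subspaceT.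
- split; last first.
  + pose g y : 'rV[R]_(dim i) := xget 0 [set x | open_disk (dim i) x /\ F x = y].
    have gP y : cell i y -> open_disk (dim i) (g y) /\ F (g y) = y.
      rewrite -FE => -[x x1 xy]; rewrite /g; case: xgetP => [z _ []//|].
      by move=> /(_ x); case.
    have gF x : open_disk (dim i) x -> g (F x) = x.
      move=> x1; have [|g1 gE] := gP (F x); first by rewrite -FE; exists x.
      exact: Finj.
    exists g; split=> //; apply/continuous_closedP => A cA.
    apply/closed_subspaceP; exists (F @` (disk (dim i) `&` A)).
      apply: compact_closed => //; apply: continuous_compact.
        exact: continuous_subspaceT.
      by apply: compact_closedI => //; exact: compact_disk.
    apply/seteqP; split=> y [].
      move=> [x [xD xA] <-] xi; split=> //.
      have -> : (g @^-1` A) (F x) = A (g (F x)) by [].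
      by rewrite gF//; exact: inner.
    move=> /= yA yi; have [g1 gE] := gP _ yi; split=> //.
    by exists (g y) => //; split => //; rewrite /disk /=; exact: ltW.
  + exact: continuous_subspaceT.
  + split=> [x x1||]; first by rewrite -FE; exists x.
      by move=> x y; rewrite !inE; exact: Finj.
    by rewrite -FE.
by exists J.
Qed.

(** * Layouts of points in columns *)

Section Layouts.
Context {R : realType}.
Implicit Types (cols : seq (R * seq R)) (s : seq (C R)).

Definition column_points (c : R * seq R) : seq (C R) := [seq mkC c.1 y | y <- c.2].

Definition layout_points cols : seq (C R) := flatten (map column_points cols).

(** A layout lists the columns from left to right, each as its abscissa with the
    increasing list of its ordinates; [r] compares successive abscissas.  With
    [<%R] the layouts of type [t] are those of the configurations of the cell
    [t]; with [<=%R] neighbouring columns may share their vertical line. *)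
Definition layout (r : rel R) (t : triple) cols : Prop :=
  let: (lam, i, j) := t in
  [/\ [seq size c.2 | c <- cols] = lam, sorted r [seq c.1 | c <- cols],
      all (fun c => sorted <%R c.2) cols &
      exists ys, [/\ nth (0, [::]) cols i.-1 = (0, ys), 0 \in ys &
                     count (< 0) ys = j]].

Definition triple_of s : triple :=
  (column_sizes s, axis_index s, num_below_origin s).

Lemma columns_sorted s : sorted <%R (columns s).
Proof. by rewrite /columns sort_lt_sorted undup_uniq. Qed.

Lemma mem_columns s x : (x \in columns s) = (x \in map real_part s).
Proof. by rewrite mem_sort mem_undup. Qed.

Lemma real_part_layout cols : all (fun c => 0 < size c.2)%N cols ->
  map real_part (layout_points cols) =i map fst cols.
Proof.
elim: cols => //= -[x ys] cols IH /andP[/= ys0 /IH{}IH] z.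
rewrite map_cat mem_cat IH inE; congr (_ || _).
rewrite -map_comp (eq_map (g := fun=> x))//.
case: ys ys0 => //= y ys _; rewrite inE orb_idr// => /mapP[? _ ->].
by rewrite eqxx.
Qed.

(** No other column contributes, the abscissas being distinct. *)
Lemma count_column cols x ys (P : pred R) :
  uniq (map fst cols) -> (x, ys) \in cols ->
  count (fun z => (real_part z == x) && P (imag_part z)) (layout_points cols) =
  count P ys.
Proof.
have colE c : count (fun z => (real_part z == x) && P (imag_part z))
    (column_points c) = if c.1 == x then count P c.2 else 0%N.
  rewrite count_map; case: eqP => [->|/eqP/negbTE cx].
    by apply: eq_count => y /=; rewrite eqxx.
  by rewrite (@eq_count _ _ pred0) ?count_pred0// => y /=; rewrite cx.
have rest c0 : x \notin map fst c0 -> count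
    (fun z => (real_part z == x) && P (imag_part z)) (layout_points c0) = 0%N.
  elim: c0 => //= c c0 IH; rewrite inE negb_or => /andP[xc /IH{}IH].
  by rewrite count_cat IH colE eq_sym (negbTE xc).
elim: cols => //= c cols IH /andP[cn un]; rewrite inE count_cat colE.
case/predU1P => [cE|xc]; first by rewrite -cE in cn *; rewrite eqxx rest ?addn0.
have -> : (c.1 == x) = false.
  by apply: contraNF cn => /eqP ->; apply/mapP; exists (x, ys).
exact: IH.
Qed.

Lemma triple_of_perm s s' : perm_eq s s' -> triple_of s = triple_of s'.
Proof.
move=> h; have hc : columns s = columns s'.
  apply: lt_sorted_eq; rewrite ?columns_sorted// => x.
  by rewrite !mem_columns; apply: perm_mem; exact: perm_map.
rewrite /triple_of /column_sizes /axis_index /num_below_origin hc.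
congr (_, _, _); last exact/seq.permP.
by apply: eq_map => x; exact/seq.permP.
Qed.

(** The columns of a strict layout have distinct abscissas, so they are the fibres
    of the real part. *)
Lemma strict_layout_triple lam i j cols :
  all (fun p => 0 < p)%N lam -> (0 < i)%N ->
  layout <%R (lam, i, j) cols -> triple_of (layout_points cols) = (lam, i, j).
Proof.
move=> lam0 i0 [lamE sX _ [ys [nthi ys0 jE]]].
have pos : all (fun c => 0 < size c.2)%N cols by rewrite -lamE all_map in lam0.
have un : uniq (map fst cols) by move: sX; rewrite lt_sorted_uniq_le => /andP[].
have colsE : columns (layout_points cols) = map fst cols.
  apply: lt_sorted_eq; rewrite ?columns_sorted// => x.
  by rewrite mem_columns real_part_layout.
have i_lt : (i.-1 < size cols)%N.
  rewrite ltnNge; apply/negP => h; move: nthi ys0.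
  by rewrite nth_default// => -[<-].
have ysc : (0, ys) \in cols by rewrite -nthi mem_nth.
rewrite /triple_of /column_sizes /axis_index /num_below_origin colsE.
congr (_, _, _).
- rewrite -lamE -map_comp; apply/eq_in_map => -[x xs] xin /=.
  rewrite -[RHS]count_predT -(count_column _ un xin).
  by apply: eq_count => z; rewrite andbT.
- have -> : 0 = nth 0 (map fst cols) i.-1 :> R.
    by rewrite (nth_map (0, [::]))// nthi.
  by rewrite index_uniq ?size_map// prednK.
by rewrite -jE -(count_column _ un ysc).
Qed.

Definition columns_of s : seq (R * seq R) :=
  [seq (x, sort <=%R [seq imag_part z | z <- s & real_part z == x])
  | x <- columns s].

Lemma perm_fibers (xs : seq R) s : uniq xs -> {subset map real_part s <= xs} ->
  perm_eq s (flatten [seq [seq z <- s | real_part z == x] | x <- xs]).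
Proof.
elim: xs s => [|x xs IH] s /=.
  by case: s => // z s _ /(_ (real_part z)); rewrite inE eqxx => /(_ isT).
move=> /andP[xn un] sub.
rewrite -(perm_filterC (fun z => real_part z == x) s) perm_cat2l.
have {IH} := IH [seq z <- s | real_part z != x] un.
set L := flatten _; set L' := flatten _; suff -> : L = L'.
  apply=> y /mapP[z]; rewrite mem_filter => /andP[zx zs] ->.
  have : real_part z \in x :: xs by apply: sub; exact: map_f.
  by rewrite inE (negbTE zx).
congr flatten; apply/eq_in_map => y ys; rewrite -filter_predI.
apply: eq_filter => z /=; case: eqP => //= ->.
by apply: contraNneq xn => <-.
Qed.

(** Grouping the points by real part loses none of them, since every real part
    occurs among the columns. *)
Lemma perm_columns_of s : perm_eq s (layout_points (columns_of s)).
Proof.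
have := @perm_fibers (columns s) s; have := columns_sorted s.
rewrite lt_sorted_uniq_le => /andP[un _] /(_ un).
have sub : {subset map real_part s <= columns s} by move=> x; rewrite mem_columns.
move=> /(_ sub) /perm_trans; apply; rewrite /layout_points -map_comp.
elim: (columns s) => //= x xs IH; apply: perm_cat => //.
rewrite /column_points /=.
have h : perm_eq (sort <=%R [seq imag_part z | z <- s & real_part z == x])
   [seq imag_part z | z <- s & real_part z == x] by rewrite perm_sort.
rewrite perm_sym; apply: perm_trans (perm_map _ h) _; rewrite -map_comp.
rewrite (_ : map _ _ = [seq z <- s | real_part z == x])//.
rewrite -[RHS]map_id; apply/eq_in_map => -[a b].
by rewrite mem_filter => /andP[/eqP <- _].
Qed.

Lemma layout_columns_of s : uniq s -> 0 \in s ->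
  layout <%R (triple_of s) (columns_of s).
Proof.
move=> us s0; rewrite /triple_of /layout.
have z0 : 0 \in columns s by rewrite mem_columns; apply/mapP; exists 0.
split.
- rewrite /columns_of -map_comp /column_sizes; apply: eq_map => x /=.
  by rewrite size_sort size_map size_filter.
- rewrite /columns_of -map_comp (_ : map _ _ = columns s) ?columns_sorted//.
  by rewrite -[RHS]map_id; exact: eq_map.
- apply/allP => c /mapP[x _ ->] /=; rewrite sort_lt_sorted.
  rewrite map_inj_in_uniq ?filter_uniq// => -[a b] [c' d].
  by rewrite !mem_filter => /andP[/eqP /= -> _] /andP[/eqP /= -> _] /= ->.
exists (sort <=%R [seq imag_part z | z <- s & real_part z == 0]); split.
- by rewrite (nth_map 0) ?index_mem// nth_index.
- by rewrite mem_sort; apply/mapP; exists 0 => //; rewrite mem_filter eqxx.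
rewrite /num_below_origin (seq.permP (permEl (perm_sort _ _))) count_map count_filter.
by apply: eq_count => z /=; rewrite andbC.
Qed.

Lemma size_layout_points cols :
  size (layout_points cols) = sumn [seq size c.2 | c <- cols].
Proof. by elim: cols => //= c cols IH; rewrite size_cat IH size_map. Qed.

Lemma triple_of_index n s : size s = n.+1 -> 0 \in s ->
  is_cell_index n (triple_of s).
Proof.
move=> ss s0; have z0 : 0 \in columns s.
  by rewrite mem_columns; apply/mapP; exists 0.
rewrite /= /is_composition -andbA; apply/and4P; split.
- apply/allP => p /mapP[x]; rewrite mem_columns => /mapP[z zs ->] ->.
  by rewrite -has_count; apply/hasP; exists z => /=.
- rewrite -ss (perm_size (perm_columns_of s)) size_layout_points -map_comp.
  apply/eqP; congr sumn; apply: eq_map => x /=.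
  by rewrite size_sort size_map size_filter.
- by rewrite /axis_index /= size_map index_mem.
rewrite /part /axis_index /= (nth_map 0) ?index_mem// nth_index//.
rewrite -ltnS prednK; last by rewrite -has_count; apply/hasP; exists 0 => /=.
rewrite /num_below_origin.
have -> : count (fun z => (real_part z == 0) && (imag_part z < 0)) s =
    count (fun z => imag_part z < 0) [seq z <- s | real_part z == 0].
  by rewrite count_filter; apply: eq_count => z /=; rewrite andbC.
rewrite -[ltnRHS]size_filter -[ltnRHS](count_predC (fun z => imag_part z < 0)).
rewrite -[ltnLHS]addn0 ltn_add2l -has_count; apply/hasP; exists 0.
  by rewrite mem_filter eqxx.
by rewrite /= ltxx.
Qed.

End Layouts.

(** * Merging two neighbouring parts *)

Section Merging.
Context {R : realType}.
Implicit Types (cols : seq (R * seq R)).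

Lemma nth_cat_size (T : Type) (x0 : T) (A B : seq T) m :
  nth x0 (A ++ B) (size A + m) = nth x0 B m.
Proof. by rewrite nth_cat ltnNge leq_addr addKn. Qed.

Lemma part_cat (A B : seq nat) m : part (A ++ B) (size A + m).+1 = nth 0%N B m.
Proof. exact: nth_cat_size. Qed.

Lemma coarsening_cat (A B : seq nat) p q :
  coarsening (A ++ p :: q :: B) (size A).+1 = A ++ (p + q)%N :: B.
Proof.
rewrite /coarsening /part /= take_size_cat//.
rewrite -[in nth _ _ (size A)](addn0 (size A)) nth_cat_size.
rewrite -[in nth _ _ (size A).+1]addn1 nth_cat_size -[(size A).+2]addn2.
by rewrite drop_cat ltnNge leq_addr addKn /= drop0.
Qed.

Lemma split_at (T : Type) (x0 : T) (s : seq T) m : (m.+1 < size s)%N ->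
  exists A x y B, s = A ++ x :: y :: B /\ size A = m.
Proof.
move=> h; exists (take m s), (nth x0 s m), (nth x0 s m.+1), (drop m.+2 s).
by split; rewrite ?size_takel -?drop_nth ?cat_take_drop//; lia.
Qed.

(** This is where codimension 1 enters: one abscissa is lost, so exactly one
    value is taken twice, and by neighbours. *)
Lemma sorted_one_repetition (xs : seq R) : sorted <=%R xs ->
  size xs = (size (undup xs)).+1 ->
  exists A x B, xs = A ++ x :: x :: B /\ sorted <%R (A ++ x :: B).
Proof.
elim: xs => //= x xs IH; case: ifPn => [xxs|xxs] sx.
  move=> /eqP; rewrite eqSS => /eqP sE; exists [::], x; move: xxs sx sE.
  case: xs {IH} => // y xs xin /= /andP[xy sy] sE; exists xs.
  have yx : y = x.
    apply/eqP; rewrite eq_le xy andbT; move: xin; rewrite inE.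
    case/predU1P => [->//|/(allP (order_path_min le_trans sy))]; exact.
  split; first by rewrite yx.
  rewrite -yx; suff : sorted <%R (y :: xs) by [].
  rewrite lt_sorted_uniq_le [sorted _ _]sy andbT.
  by rewrite (uniq_size_uniq (undup_uniq (y :: xs)) (@mem_undup _ _)) /= sE.
move=> /= [sE].
have [A [z [B [xsE sAB]]]] := IH (path_sorted sx) sE.
exists (x :: A), z, B; split; first by rewrite xsE.
rewrite lt_sorted_uniq_le in sAB; have {sAB}/andP[uAB _] := sAB.
suff : sorted <%R (x :: A ++ z :: B) by [].
have sub : subseq (x :: A ++ z :: B) (x :: xs).
  by rewrite xsE /= eqxx cat_subseq// subseq_cons.
rewrite lt_sorted_uniq_le (subseq_sorted le_trans sub)// andbT /= uAB andbT.
by apply: contra xxs; rewrite xsE !mem_cat !inE => /or3P[->|->|->]; rewrite ?orbT.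
Qed.

(** The four boundary forms when the merged parts [p] and [q] are preceded by [a]
    parts: the indices (i, j) of the origin become (i', j'). *)
Inductive merge_form (a p q : nat) : nat -> nat -> nat -> nat -> Prop :=
| MergeLeftOfAxis k j : merge_form a p q (a + k.+2).+1 j (a + k.+1).+1 j
| MergeRightOfAxis i j : (0 < i <= a)%N -> merge_form a p q i j i j
| MergeIntoAxisFromLeft j h : (h <= p)%N ->
    merge_form a p q (a + 1).+1 j (a + 0).+1 (j + h)
| MergeIntoAxisFromRight j h : (h <= q)%N ->
    merge_form a p q (a + 0).+1 j (a + 0).+1 (j + h).

(** Cutting lambda around the merged parts makes the coarsening explicit. *)
Lemma boundary_formP lam i j t : (0 < i <= size lam)%N ->
  boundary_form (lam, i, j) t <->
  exists A p q B i' j', [/\ lam = A ++ p :: q :: B,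
    t = (A ++ (p + q)%N :: B, i', j') & merge_form (size A) p q i j i' j'].
Proof.
move=> hi; split.
  move E : (lam, i, j) => s0 bf.
  case: bf E => {t s0} [lam0 i0 j0 m|lam0 i0 j0 m|lam0 i0 j0 h|lam0 i0 j0 h].
  - move=> hm [? ? ?]; subst lam0 i0 j0.
    have [|A [p [q [B [lamE mE]]]]] := @split_at _ 0%N lam m.-1; first lia.
    exists A, p, q, B, i.-1, j; split=> //.
      by rewrite lamE -coarsening_cat; congr (coarsening _ _, _, _); lia.
    have [k ->] : exists k, i = (size A + k.+2).+1.
      by exists (i - size A - 3)%N; lia.
    by rewrite [_.-1](_ : _ = (size A + k.+1).+1); [exact: MergeLeftOfAxis|lia].
  - move=> hm [? ? ?]; subst lam0 i0 j0.
    have [|A [p [q [B [lamE mE]]]]] := @split_at _ 0%N lam m.-1; first lia.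
    exists A, p, q, B, i, j; split=> //.
      by rewrite lamE -coarsening_cat; congr (coarsening _ _, _, _); lia.
    by apply: MergeRightOfAxis; lia.
  - move=> i2 + [? ? ?]; subst lam0 i0 j0.
    have [|A [p [q [B [lamE mE]]]]] := @split_at _ 0%N lam i.-2; first lia.
    have iE : i = (size A + 1).+1 by lia.
    rewrite lamE iE [_.-1](_ : _ = (size A + 0).+1); last by lia.
    rewrite part_cat /= => hp; exists A, p, q, B, (size A + 0).+1, (j + h)%N.
    by split; [|rewrite addn0 coarsening_cat|exact: MergeIntoAxisFromLeft].
  move=> il + [? ? ?]; subst lam0 i0 j0.
  have [|A [p [q [B [lamE mE]]]]] := @split_at _ 0%N lam i.-1; first lia.
  have iE : i = (size A + 0).+1 by lia.
  rewrite lamE iE [_.+2](_ : _ = (size A + 1).+1); last by lia.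
  rewrite part_cat /= => hq; exists A, p, q, B, (size A + 0).+1, (j + h)%N.
  by split; [|rewrite addn0 coarsening_cat|exact: MergeIntoAxisFromRight].
case=> A [p [q [B [i' [j' [lamE -> mf]]]]]]; subst lam.
rewrite -coarsening_cat; move: hi; rewrite size_cat /=.
case: mf => {i j i' j'} [k j|i j hi|j h hp|j h hq] hi'.
- have -> : (size A + k.+1).+1 = (size A + k.+2).+1.-1 by lia.
  by apply: Form1; lia.
- by apply: Form2; rewrite size_cat /=; lia.
- have -> : (size A + 0).+1 = (size A + 1).+1.-1 by lia.
  have -> : (size A).+1 = (size A + 1).+1.-1 by lia.
  apply: Form3; first lia.
  by rewrite [_.-1](_ : _ = (size A + 0).+1) ?part_cat//; lia.
have -> : (size A).+1 = (size A + 0).+1 by lia.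
apply: Form4; first by rewrite size_cat /=; lia.
by rewrite [_.+2](_ : _ = (size A + 1).+1) ?part_cat//; lia.
Qed.

Lemma boundary_form_index n t t' : is_cell_index n t -> boundary_form t t' ->
  is_cell_index n t' /\ size t.1.1 = (size t'.1.1).+1.
Proof.
case: t => [[lam i] j] /and3P[/andP[pos sm] hi hj].
move=> /(boundary_formP _ _ hi)[A [p [q [B [i' [j' [lamE -> mf]]]]]]].
subst lam; move: hi hj pos sm.
rewrite /is_cell_index /is_composition.
rewrite !all_cat !sumn_cat !size_cat /=.
move=> + + /and4P[-> p0 q0 ->]; rewrite addn_gt0 p0 /= addnA.
case: mf => [k j0|i0 j0 i0A|j0 h hp|j0 h hq]; rewrite ?part_cat ?nth_cat_size /=.
- by move=> hi hj sm; split; lia.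
- rewrite /part !nth_cat; have -> : (i0.-1 < size A)%N by lia.
  by move=> hi hj sm; split; lia.
- by move=> hi hj sm; split; lia.
- by move=> hi hj sm; split; lia.
Qed.

End Merging.

(** * Merging and splitting columns *)

Section MergingLayouts.
Context {R : realType}.
Implicit Types (cols : seq (R * seq R)).

Lemma map_eq_cat (T S : Type) (f : T -> S) (s : seq T) A B : map f s = A ++ B ->
  exists s1 s2, [/\ s = s1 ++ s2, map f s1 = A & map f s2 = B].
Proof.
move=> h; exists (take (size A) s), (drop (size A) s); split.
- by rewrite cat_take_drop.
- by rewrite map_take h take_size_cat.
by rewrite map_drop h drop_size_cat.
Qed.

Lemma map_eq_cons (T S : Type) (f : T -> S) (s : seq T) a B : map f s = a :: B ->
  exists b s2, [/\ s = b :: s2, f b = a & map f s2 = B].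
Proof. by case: s => //= b s2 [? ?]; exists b, s2. Qed.

Lemma layout_points_cat (c1 c2 : seq (R * seq R)) :
  layout_points (c1 ++ c2) = layout_points c1 ++ layout_points c2.
Proof. by rewrite /layout_points map_cat flatten_cat. Qed.

Lemma perm_layout_merge (CA CB : seq (R * seq R)) x u v ys : perm_eq ys (u ++ v) ->
  perm_eq (layout_points (CA ++ (x, u) :: (x, v) :: CB))
          (layout_points (CA ++ (x, ys) :: CB)).
Proof.
move=> h; rewrite !layout_points_cat perm_cat2l /layout_points /= catA perm_cat2r.
by rewrite /column_points /= -map_cat perm_sym perm_map.
Qed.

(** The two columns on the same line are merged by sorting.  If one of them is the
    axis, the number h is the number of points of the other one below the
    origin. *)
Lemma merge_layout lam i j cols : (0 < i <= size lam)%N ->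
  layout <=%R (lam, i, j) cols -> uniq (layout_points cols) ->
  size lam = (size (undup (map fst cols))).+1 ->
  exists t cols', [/\ boundary_form (lam, i, j) t, layout <%R t cols' &
                      perm_eq (layout_points cols) (layout_points cols')].
Proof.
move=> hi [lamE sX sY [ys [nthi ys0 jE]]] upts szE.
have szX : size (map fst cols) = (size (undup (map fst cols))).+1.
  by rewrite -szE -lamE !size_map.
have [AX [x [BX [XE sX']]]] := sorted_one_repetition sX szX.
have [CA [C1 [colsE CAE C1E]]] := map_eq_cat XE.
have [[x1 u] [C2 [C1E' /= xE C2E]]] := map_eq_cons C1E.
have [[x2 v] [CB [C2E' /= xE2 CBE]]] := map_eq_cons C2E.
move: colsE; rewrite {}C1E' {}C2E' {}xE {}xE2 => {C1 C2 C1E C2E} colsE; subst cols.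
pose w := sort <=%R (u ++ v).
have wE : perm_eq w (u ++ v) by rewrite perm_sort.
have [sCA su sv sCB] : [/\ all (fun c => sorted <%R c.2) CA, sorted <%R u,
    sorted <%R v & all (fun c => sorted <%R c.2) CB].
  by move: sY; rewrite all_cat /= => /and4P[].
have sw : sorted <%R w.
  rewrite sort_lt_sorted; have : uniq (layout_points [:: (x, u); (x, v)]).
    move: upts; rewrite layout_points_cat cat_uniq => /and3P[_ _].
    rewrite -[_ :: _ :: _]/([:: (x, u); (x, v)] ++ CB) layout_points_cat.
    by rewrite cat_uniq => /andP[].
  by rewrite /layout_points /= cats0 /column_points -map_cat => /map_uniq.
pose A := map (fun c : R * seq R => size c.2) CA.
pose B := map (fun c : R * seq R => size c.2) CB.
have szA : size A = size CA by rewrite size_map.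
have main i' j' : merge_form (size A) (size u) (size v) i j i' j' ->
    (exists ys, [/\ nth (0, [::]) (CA ++ (x, w) :: CB) i'.-1 = (0, ys),
       0 \in ys & count (< 0) ys = j']) ->
  exists t cols', [/\ boundary_form (lam, i, j) t, layout <%R t cols' &
    perm_eq (layout_points (CA ++ (x, u) :: (x, v) :: CB)) (layout_points cols')].
  move=> mf ax; exists (A ++ (size u + size v)%N :: B, i', j').
  exists (CA ++ (x, w) :: CB); split; last by apply: perm_layout_merge.
    apply/boundary_formP => //; exists A, (size u), (size v), B, i', j'.
    by split => //; rewrite -lamE map_cat.
  split=> //.
  - by rewrite map_cat /= (perm_size wE) size_cat.
  - by rewrite map_cat /= CAE CBE.
  - by rewrite all_cat /= sCA sw.
have [iA|iA] := leqP i (size CA).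
  apply: (main i j).
    by apply: MergeRightOfAxis; clear -hi iA szA; lia.
  exists ys; split => //; rewrite -nthi !nth_cat.
  by have -> : (i.-1 < size CA)%N by clear -hi iA; lia.
have [[|[|k]] iE] : exists m, i = (size CA + m).+1.
  by exists (i - (size CA).+1)%N; clear -iA; lia.
- have iE' : i.-1 = (size CA + 0)%N by rewrite iE.
  move: nthi; rewrite iE' nth_cat_size /= => -[x0 uE]; subst ys.
  apply: (main i (j + count (< 0)%R v)%N).
    by rewrite iE -szA; apply: MergeIntoAxisFromRight; exact: count_size.
  exists w; rewrite iE' nth_cat_size /= x0; split => //.
    by rewrite (perm_mem wE) mem_cat ys0.
  by rewrite (seq.permP wE) count_cat jE.
- have iE' : i.-1 = (size CA + 1)%N by rewrite iE.
  move: nthi; rewrite iE' nth_cat_size /= => -[x0 vE]; subst ys.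
  apply: (main (size A + 0).+1 (j + count (< 0)%R u)%N).
    by rewrite iE -szA; apply: MergeIntoAxisFromLeft; exact: count_size.
  exists w; rewrite szA nth_cat_size /= x0; split => //.
    by rewrite (perm_mem wE) mem_cat ys0 orbT.
  by rewrite (seq.permP wE) count_cat jE addnC.
have iE' : i.-1 = (size CA + k.+2)%N by rewrite iE.
apply: (main (size A + k.+1).+1 j).
  by rewrite iE -szA; exact: MergeLeftOfAxis.
by exists ys; split => //; rewrite szA nth_cat_size -nthi iE' nth_cat_size.
Qed.

Lemma sorted_repeat (A B : seq R) x :
  sorted <%R (A ++ x :: B) -> sorted <=%R (A ++ x :: x :: B).
Proof.
move=> /(sub_sorted ltW).
by case: A => [|a A] /=; rewrite ?lexx// !cat_path /= lexx.
Qed.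

(** Splitting the axis: [u] stays on the axis and [v] leaves it.  One keeps the
    first j points below the origin and enough points above it to reach the
    size p. *)
Lemma split_axis (ys : seq R) p q j h : sorted <%R ys -> 0 \in ys ->
  count (< 0) ys = (j + h)%N -> size ys = (p + q)%N -> (j < p)%N -> (h <= q)%N ->
  exists u v, [/\ perm_eq ys (u ++ v), sorted <%R u /\ sorted <%R v,
    size u = p, size v = q & 0 \in u /\ count (< 0) u = j].
Proof.
move=> sy y0 cy sz jp hq.
pose lo : seq R := [seq y <- ys | y < 0]; pose hi : seq R := [seq y <- ys | 0 < y].
have uy : uniq ys by move: sy; rewrite lt_sorted_uniq_le => /andP[].
have ysE : perm_eq ys (lo ++ 0 :: hi).
  apply: uniq_perm => //.
    rewrite cat_uniq /= !filter_uniq// !mem_filter !ltxx /= andbT.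
    apply/hasPn => y; rewrite !mem_filter => /andP[y1 _].
    by rewrite lt_gtF.
  move=> y; rewrite mem_cat inE !mem_filter.
  by case: (ltgtP y 0) => [||->]; rewrite ?orbF ?y0//= orbF.
have szlo : size lo = (j + h)%N by rewrite size_filter.
have szhi : (size hi).+1 = (p - j + (q - h))%N.
  by have := perm_size ysE; rewrite size_cat /= sz szlo; lia.
have tlo : size (take j lo) = j by rewrite size_takel// szlo leq_addr.
have thi : size (take (p - j).-1 hi) = (p - j).-1 by rewrite size_takel; lia.
pose u := sort <=%R (take j lo ++ 0 :: take (p - j).-1 hi).
pose v := sort <=%R (drop j lo ++ drop (p - j).-1 hi).
have uE : perm_eq u (take j lo ++ 0 :: take (p - j).-1 hi) by rewrite perm_sort.
have vE : perm_eq v (drop j lo ++ drop (p - j).-1 hi) by rewrite perm_sort.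
have uvE : perm_eq ys (u ++ v).
  rewrite (perm_trans ysE)// perm_sym (perm_trans (perm_cat uE vE))//.
  rewrite -[in X in perm_eq _ X](cat_take_drop j lo).
  rewrite -[in X in perm_eq _ X](cat_take_drop (p - j).-1 hi).
  rewrite -!catA perm_cat2l -cat_cons perm_catCA perm_cat2l.
  by rewrite cat_cons.
have : uniq (u ++ v) by rewrite -(perm_uniq uvE).
rewrite cat_uniq => /and3P[uu _ uv].
have sorts (l : seq R) : uniq (sort <=%R l) -> sorted <%R (sort <=%R l).
  by rewrite sort_uniq sort_lt_sorted.
exists u, v; split=> //.
- by split; exact: sorts.
- by rewrite (perm_size uE) size_cat /= tlo thi; clear -jp; lia.
- rewrite (perm_size vE) size_cat !size_drop szlo; move: (size hi) szhi => k.
  by clear -jp hq; lia.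
split; first by rewrite (perm_mem uE) mem_cat inE eqxx orbT.
rewrite (seq.permP uE) count_cat /= ltxx add0n.
rewrite (_ : count _ (take (p - j).-1 hi) = 0%N); last first.
  apply/eqP; rewrite -leqn0 leqNgt -has_count; apply/hasPn => y /mem_take.
  by rewrite mem_filter => /andP[y1 _]; rewrite /= lt_gtF.
rewrite addn0; apply/eqP; rewrite -[X in _ == X]tlo.
rewrite -all_count; apply/allP => y /mem_take.
by rewrite mem_filter => /andP[].
Qed.

(** Away from the axis the merged column is simply cut at the right size, since no
    condition bears on the ordinates of different columns. *)
Lemma split_layout n lam i j t cols' : is_cell_index n (lam, i, j) ->
  boundary_form (lam, i, j) t -> layout <%R t cols' ->
  exists2 cols, layout <=%R (lam, i, j) cols &
    perm_eq (layout_points cols) (layout_points cols').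
Proof.
move=> /and3P[/andP[pos _] hi hj] /(boundary_formP _ _ hi).
case=> A [p [q [B [i' [j' [lamE -> mf]]]]]] [szE sX sY [zs [nthi zs0 jE]]].
subst lam.
have [CA [C1 [colsE CAE C1E]]] := map_eq_cat szE.
have [[x ys] [CB [C1E' /= yE CBE]]] := map_eq_cons C1E.
move: colsE; rewrite {}C1E' => {C1 C1E} colsE; subst cols'.
have szA : size A = size CA by rewrite -CAE size_map.
have [sCA sy sCB] : [/\ all (fun c => sorted <%R c.2) CA, sorted <%R ys &
    all (fun c => sorted <%R c.2) CB].
  by move: sY; rewrite all_cat /= => /and3P[].
have main u v : perm_eq ys (u ++ v) -> sorted <%R u -> sorted <%R v ->
    size u = p -> size v = q ->
    (exists zs, [/\ nth (0, [::]) (CA ++ (x, u) :: (x, v) :: CB) i.-1 = (0, zs),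
       0 \in zs & count (< 0) zs = j]) ->
  exists2 cols, layout <=%R (A ++ p :: q :: B, i, j) cols &
    perm_eq (layout_points cols) (layout_points (CA ++ (x, ys) :: CB)).
  move=> uvE su sv uE vE ax; exists (CA ++ (x, u) :: (x, v) :: CB).
    split=> //.
    - by rewrite map_cat /= CAE CBE uE vE.
    - by move: sX; rewrite !map_cat; exact: sorted_repeat.
    - by rewrite all_cat /= sCA su sv.
  exact: perm_layout_merge.
have tk : perm_eq ys (take p ys ++ drop p ys) by rewrite cat_take_drop.
have st : sorted <%R (take p ys).
  by apply: subseq_sorted sy; [exact: lt_trans|exact: take_subseq].
have sd : sorted <%R (drop p ys).
  by apply: subseq_sorted sy; [exact: lt_trans|exact: drop_subseq].
have szt : size (take p ys) = p by rewrite size_takel// yE leq_addr.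
have szd : size (drop p ys) = q by rewrite size_drop yE addKn.
case: mf => {i j i' j'} [k j|i j hiA|j h hp|j h hq] in hi hj nthi jE main *.
- apply: (main (take p ys) (drop p ys)) => //.
  exists zs; split => //; move: nthi.
  by rewrite /= szA !nth_cat_size.
- apply: (main (take p ys) (drop p ys)) => //.
  exists zs; split => //; move: nthi; rewrite szA in hiA.
  rewrite !nth_cat; suff -> : (i.-1 < size CA)%N by [].
  by clear -hiA; lia.
- rewrite [_.-1]/= szA nth_cat_size /= in nthi; case: nthi => x0 ?; subst zs.
  rewrite part_cat /= in hj; rewrite addnC in yE.
  have q0 : (0 < q)%N by move: pos; rewrite all_cat /= => /and4P[].
  have [|v [u [uvE [sv su] vE uE [v0 vj]]]] := split_axis sy zs0 jE yE _ hp.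
    by clear -hj q0; lia.
  apply: (main u v) => //; first by rewrite (perm_trans uvE)// perm_catC.
  by exists v; split => //; rewrite szA nth_cat_size /= x0.
rewrite [_.-1]/= szA nth_cat_size /= in nthi; case: nthi => x0 ?; subst zs.
rewrite part_cat /= in hj.
have p0 : (0 < p)%N by move: pos; rewrite all_cat /= => /and3P[].
have [|u [v [uvE [su sv] uE vE [u0 uj]]]] := split_axis sy zs0 jE yE _ hq.
  by clear -hj p0; lia.
apply: (main u v) => //.
by exists u; split => //; rewrite szA nth_cat_size /= x0.
Qed.

End MergingLayouts.

(** * Gaps between consecutive points *)

Section Gaps.
Context {R : realType}.
Implicit Types (s : bool) (x y : R).

(** With [s] true, (1 + x) / (1 - x) maps [-1, 1] onto [0, oo]; with [s] false,
    x / (1 - |x|) maps it onto [-oo, oo].  The gap is infinite where the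
    denominator vanishes. *)
Definition gap_num s x := if s then 1 + x else x.
Definition gap_den s x := if s then 1 - x else 1 - `|x|.
Definition gap s x := gap_num s x / gap_den s x.
Definition gap_inv s y := if s then (y - 1) / (y + 1) else y / (1 + `|y|).

Lemma gap_den_neq0 s x : `|x| < 1 -> gap_den s x != 0.
Proof.
rewrite /gap_den => x1; rewrite gt_eqF//; case: s; rewrite subr_gt0//.
exact: le_lt_trans (ler_norm _) x1.
Qed.

Lemma gap_invK s y : (s -> 0 <= y) ->
  gap_den s (gap_inv s y) != 0 /\ gap s (gap_inv s y) = y.
Proof.
rewrite /gap /gap_den /gap_num /gap_inv; case: s => [/(_ isT) y0|_].
  have y1 : y + 1 != 0 by rewrite gt_eqF// ltr_pwDr.
  have E : 1 - (y - 1) / (y + 1) = 2 / (y + 1) by field.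
  have N : 2 / (y + 1) != 0 by rewrite mulf_neq0// ?invr_neq0// pnatr_eq0.
  by rewrite E; split => //; field; rewrite y1.
have y1 : 1 + `|y| != 0 by rewrite gt_eqF// ltr_pwDl.
have E : 1 - `|y / (1 + `|y|)| = (1 + `|y|)^-1.
  by rewrite normrM normfV (ger0_norm (_ : 0 <= 1 + `|y|)) ?addr_ge0//; field.
by rewrite E invr_eq0 y1 invrK divfK.
Qed.

Lemma gapK s x : `|x| < 1 -> gap_inv s (gap s x) = x.
Proof.
move=> x1; have := gap_den_neq0 s x1.
rewrite /gap /gap_den /gap_num /gap_inv; case: s => dx.
  by field; rewrite dx /=; apply/eqP; lra.
have d0 : 0 < 1 - `|x| by rewrite subr_gt0.
rewrite normrM normfV (gtr0_norm d0).
have E : 1 + `|x| / (1 - `|x|) = (1 - `|x|)^-1 by field.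
by rewrite E invrK divfK.
Qed.

Lemma gap_inv_le1 s y : (s -> 0 <= y) -> `|gap_inv s y| <= 1.
Proof.
rewrite /gap_inv; case: s => [/(_ isT) y0|_].
  have y1 : 0 < y + 1 by rewrite ltr_pwDr.
  by rewrite ler_norml ler_pdivrMr// ler_pdivlMr//; apply/andP; split; lra.
have y1 : 0 < 1 + `|y| by rewrite ltr_pwDl.
by rewrite normrM normfV (gtr0_norm y1) ler_pdivrMr// mul1r lerDr.
Qed.

Lemma gap_inv_lt1 s y : (s -> 0 < y) -> `|gap_inv s y| < 1.
Proof.
rewrite /gap_inv; case: s => [/(_ isT) y0|_].
  have y1 : 0 < y + 1 by rewrite addr_gt0.
  by rewrite ltr_norml ltr_pdivrMr// ltr_pdivlMr//; apply/andP; split; lra.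
have y1 : 0 < 1 + `|y| by rewrite ltr_pwDl.
by rewrite normrM normfV (gtr0_norm y1) ltr_pdivrMr// mul1r ltrDr.
Qed.

Lemma gap_ge0 x : `|x| <= 1 -> 0 <= gap true x.
Proof.
by rewrite ler_norml => /andP[? ?]; rewrite divr_ge0//= ?subr_ge0// -lerBlDl sub0r.
Qed.

Lemma gap_gt0 x : `|x| < 1 -> 0 < gap true x.
Proof.
by rewrite ltr_norml => /andP[? ?]; rewrite divr_gt0//= ?subr_gt0// -ltrBlDl sub0r.
Qed.

Lemma gap_num_continuous s : continuous (gap_num s).
Proof.
case: s => x; rewrite /gap_num /=; last exact: cvg_id.
by apply: cvgD; [exact: cvg_cst|exact: cvg_id].
Qed.

Lemma gap_den_continuous s : continuous (gap_den s).
Proof.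
case: s => x; rewrite /gap_den /=; apply: cvgB; try exact: cvg_cst.
  exact: cvg_id.
exact: norm_continuous.
Qed.

Lemma gap_continuous s x : gap_den s x != 0 -> {for x, continuous (gap s)}.
Proof.
move=> dx; apply: cvgM; first exact: gap_num_continuous.
by apply: cvgV => //; exact: gap_den_continuous.
Qed.

Lemma near_gap_den s x : gap_den s x != 0 -> \forall y \near x, gap_den s y != 0.
Proof.
move=> dx; have : nbhs (gap_den s x) [set z : R | z != 0].
  by apply: open_nbhs_nbhs; split; [exact: open_neq|].
by move=> /gap_den_continuous.
Qed.

(** The numerator does not vanish where the denominator does, so
    [gap_num ^ 2 - K * gap_den ^ 2] is positive near such a point. *)
Lemma gap_blowup s x (K : R) : gap_den s x = 0 ->
  \forall y \near x, gap_den s y != 0 -> K < gap s y ^+ 2.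
Proof.
move=> dx; pose f y := gap_num s y ^+ 2 - K * gap_den s y ^+ 2.
have sq (g : R -> R) : continuous g -> continuous (fun y => g y ^+ 2).
  move=> gc y; apply: (@continuous_comp _ _ _ g (fun t : R => t ^+ 2)).
    exact: gc.
  exact: exprn_continuous.
have fc : continuous f.
  move=> y; apply: cvgB; first exact/sq/gap_num_continuous.
  by apply: cvgM; [exact: cvg_cst|exact/sq/gap_den_continuous].
have fx : 0 < f x.
  rewrite /f dx expr0n mulr0 subr0 exprn_even_gt0//=; apply/eqP.
  move: dx; rewrite /gap_den /gap_num; case: s {f fc} => dx; first by lra.
  by move=> x0; move: dx; rewrite x0 normr0; lra.
have : nbhs (f x) [set z | 0 < z].
  by apply: open_nbhs_nbhs; split; [exact: open_gt|].
move=> /fc; apply: (@filterS _ _ (nbhs_filter x)) => y; rewrite /f /= subr_gt0 => h dy.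
rewrite /gap expr_div_n ltr_pdivlMr// exprn_even_gt0//=.
Qed.

End Gaps.

(** * Parametrization of a closed cell by a cube *)

Lemma mkseq_flatten (T : Type) (lam : seq nat) (F : nat -> T) :
  mkseq F (sumn lam) =
  flatten (mkseq (fun m => mkseq (fun c => F (flatten_index lam m c)) (nth 0%N lam m))
                 (size lam)).
Proof.
set L := mkseq _ (size lam).
have shE : shape L = lam.
  rewrite /shape /L {1}/mkseq -map_comp -[RHS](mkseq_nth 0%N).
  by apply: eq_map => m; rewrite /= size_mkseq.
case: (posnP (sumn lam)) => [s0|s0].
  by rewrite s0; symmetry; apply/size0nil; rewrite size_flatten shE.
have x0 := F 0%N.
apply: (@eq_from_nth _ x0); first by rewrite size_mkseq size_flatten shE.
move=> p; rewrite size_mkseq => pN.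
have rP : (reshape_index lam p < size lam)%N by exact: reshape_indexP.
rewrite nth_mkseq// nth_flatten shE nth_mkseq// nth_mkseq ?reshape_indexK//.
exact: reshape_offsetP.
Qed.

Lemma sorted_mkseq (T : Type) (r : rel T) (f : nat -> T) l :
  (forall m, (m.+1 < l)%N -> r (f m) (f m.+1)) -> sorted r (mkseq f l).
Proof.
case: l => // l h; apply/(sortedP (f 0%N)) => m; rewrite size_mkseq => ml.
by rewrite !nth_mkseq ?h// ltnW.
Qed.

Lemma iota_bump n p : (p <= n)%N ->
  perm_eq (iota 0 n.+1) (p :: map (bump p) (iota 0 n)).
Proof.
move=> pn; apply: uniq_perm; first exact: iota_uniq.
  rewrite /= map_inj_uniq ?iota_uniq ?andbT; last exact: (can_inj (bumpK p)).
  by apply/mapP => -[k _] /eqP; rewrite (negbTE (neq_bump p k)).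
move=> q; rewrite mem_iota inE add0n leq0n /=.
apply/idP/idP => [qn|/predU1P[->|/mapP[k]]]; last first.
- by rewrite mem_iota /bump => kn ->; lia.
- by lia.
case: eqVneq => //= qp; apply/mapP; exists (unbump p q).
  by rewrite mem_iota /unbump; lia.
by rewrite unbumpK.
Qed.

Lemma sorted_count_nth (R : realType) (ys : seq R) k : sorted <%R ys ->
  (k < size ys)%N -> count (< nth 0 ys k) ys = k.
Proof.
move=> sy ks; rewrite -[in X in count _ X](cat_take_drop k ys) count_cat.
have tk : size (take k ys) = k by rewrite size_takel// ltnW.
rewrite (_ : count _ (take k ys) = k); last first.
  apply/eqP; rewrite -[X in _ == X]tk -all_count.
  apply/(all_nthP 0) => m; rewrite tk => mk; rewrite nth_take//=.
  by rewrite (lt_sorted_ltn_nth 0 sy)// inE (ltn_trans mk).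
rewrite (_ : count _ _ = 0%N) ?addn0//.
apply/eqP; rewrite -leqn0 leqNgt -has_count -all_predC.
apply/(all_nthP 0) => m; rewrite size_drop nth_drop /= => mk; rewrite -leNgt.
have kmE : (k + m < size ys)%N by lia.
by rewrite (lt_sorted_leq_nth 0 sy) ?leq_addr.
Qed.

Section Parametrization.
Context {R : realType} (n : nat) (lam : seq nat) (i j : nat).
Hypothesis valid : is_cell_index n (lam, i, j).

Let d := (n + size lam - 1)%N.
Implicit Types u : 'rV[R]_d.

Definition col p := reshape_index lam p.
Definition origin_pos := flatten_index lam i.-1 j.
Definition same_col q := col q == col q.+1.

Lemma parts_gt0 : all (fun p => 0 < p)%N lam.
Proof. by have /and3P[/andP[]] := valid. Qed.

Lemma sumn_parts : sumn lam = n.+1.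
Proof. by have /and3P[/andP[_ /eqP]] := valid. Qed.

Lemma part_gt0 m : (m < size lam)%N -> (0 < nth 0 lam m)%N.
Proof. by move=> ml; apply: (allP parts_gt0); exact: mem_nth. Qed.

Lemma axis_lt : (i.-1 < size lam)%N.
Proof. by have /and3P[_ hi _] := valid; lia. Qed.

Lemma origin_off : (j < nth 0 lam i.-1)%N.
Proof.
have /and3P[_ _] := valid; have := part_gt0 axis_lt; rewrite /part; lia.
Qed.

Lemma flatten_index_lt m c : (m < size lam)%N -> (c < nth 0 lam m)%N ->
  (flatten_index lam m c < n.+1)%N.
Proof. by move=> ml cm; rewrite -sumn_parts; exact: flatten_indexP. Qed.

Lemma col_flatten_index m c : (c < nth 0 lam m)%N -> col (flatten_index lam m c) = m.
Proof. by move=> cm; rewrite /col flatten_indexKl. Qed.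

Lemma col_lt p : (p < n.+1)%N -> (col p < size lam)%N.
Proof. by rewrite -sumn_parts; exact: reshape_indexP. Qed.

Lemma col_mono p q : (p <= q)%N -> (col p <= col q)%N.
Proof.
by rewrite (@reshape_leq lam) => /orP[/ltnW|/andP[/eqP h _]]; rewrite // /col h.
Qed.

Lemma origin_lt : (origin_pos < n.+1)%N.
Proof. exact: flatten_index_lt axis_lt origin_off. Qed.

Lemma col_origin : col origin_pos = i.-1.
Proof. exact: col_flatten_index origin_off. Qed.

(** Indexing the coordinates by natural numbers, with a default value out of
    bounds, avoids bound proofs in the sums below: the first [n] coordinates
    are the gaps between ordinates, the others the gaps between abscissas. *)
Definition coord u k : R := if insub k is Some a then u ord0 a else 0.

Lemma coord_ord u (a : 'I_d) : coord u a = u ord0 a.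
Proof. by rewrite /coord valK. Qed.

Lemma coord_le u k (a : R) : `|u| <= a -> `|coord u k| <= a.
Proof.
move=> ua; rewrite /coord; case: insubP => [b _ _|_].
  exact: le_trans (mx_norm_coord _ _) ua.
by rewrite normr0 (le_trans _ ua).
Qed.

Lemma coord_lt u k (a : R) : `|u| < a -> `|coord u k| < a.
Proof. by apply: le_lt_trans; exact: coord_le. Qed.

Lemma coord_fun_continuous k : continuous (coord^~ k).
Proof.
rewrite /coord; case: insubP => [b _ _|_] u; first exact: coord_continuous.
exact: cst_continuous.
Qed.

Definition ygap u q := gap (same_col q) (coord u q).
Definition xgap u r := gap true (coord u (n + r)).
(** The second sum normalizes the abscissa of the column of the origin to 0. *)
Definition abscissa u m :=
  \sum_(0 <= r < m) xgap u r - \sum_(0 <= r < i.-1) xgap u r.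
Definition ordinate u p :=
  \sum_(0 <= q < p) ygap u q - \sum_(0 <= q < origin_pos) ygap u q.
Definition chain u p : C R := mkC (abscissa u (col p)) (ordinate u p).

Definition finite_gaps u : Prop :=
  (forall q, (q < n)%N -> gap_den (same_col q) (coord u q) != 0) /\
  (forall r, (r.+1 < size lam)%N -> gap_den true (coord u (n + r)) != 0).

Definition chain_row u : 'rV[C R]_n := \row_k chain u (bump origin_pos k).

(** Collisions in the chain need no case of their own: [conf_of] sends them to the
    point at infinity. *)
Definition cell_map u : Conf_compactified R n :=
  if pselect (finite_gaps u) then conf_of (chain_row u) else None.

Lemma abscissaS u m : abscissa u m.+1 - abscissa u m = xgap u m.
Proof. rewrite /abscissa big_nat_recr//=; ring. Qed.

Lemma ordinateS u p : ordinate u p.+1 - ordinate u p = ygap u p.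
Proof. rewrite /ordinate big_nat_recr//=; ring. Qed.

Lemma chain_origin u : chain u origin_pos = 0.
Proof. by rewrite /chain col_origin /abscissa /ordinate !subrr. Qed.

Lemma perm_chain u : perm_eq (0 :: points (chain_row u)) (mkseq (chain u) n.+1).
Proof.
rewrite /mkseq perm_sym -[X in X :: _](chain_origin u).
apply: perm_trans (perm_map _ (iota_bump (n := n) (p := origin_pos) _)) _.
  exact: origin_lt.
rewrite /= perm_cons -map_comp -val_enum_ord -map_comp /points.
by under [X in perm_eq _ X]eq_map => k do rewrite mxE.
Qed.

Definition chain_layout u : seq (R * seq R) :=
  mkseq (fun m => (abscissa u m,
    mkseq (fun c => ordinate u (flatten_index lam m c)) (nth 0%N lam m)))
  (size lam).

Lemma layout_points_chain u : layout_points (chain_layout u) = mkseq (chain u) n.+1.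
Proof.
rewrite -sumn_parts mkseq_flatten /layout_points /chain_layout /mkseq -map_comp.
congr flatten; apply/eq_in_map => m; rewrite mem_iota => /andP[_ ml].
rewrite /column_points /= -map_comp; apply/eq_in_map => c.
by rewrite mem_iota => /andP[_ cm] /=; rewrite /chain col_flatten_index.
Qed.

Lemma near_finite_gaps u : finite_gaps u -> \forall w \near u, finite_gaps w.
Proof.
move=> [fy fx].
have step s k : gap_den s (coord u k) != 0 ->
    \forall w \near u, gap_den s (coord w k) != 0.
  by move=> /near_gap_den; exact: coord_fun_continuous.
have hy : \forall w \near u, forall q : 'I_n, gap_den (same_col q) (coord w q) != 0.
  by apply: (filter_forall (nbhs_filter u)) => q; apply/step/fy.
have hx : \forall w \near u, forall r : 'I_((size lam).-1),
    gap_den true (coord w (n + r)) != 0.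
  apply: (filter_forall (nbhs_filter u)) => r; apply/step/fx.
  by have := ltn_ord r; lia.
apply: (@filterS2 _ _ (nbhs_filter u) _ _ _ _ hy hx) => w wy wx.
split=> [q qn|r rl]; first exact: (wy (Ordinal qn)).
have rl' : (r < (size lam).-1)%N by lia.
exact: (wx (Ordinal rl')).
Qed.

Lemma sum_gap_continuous (s : nat -> bool) (k : nat -> nat) a u :
  (forall q, (q < a)%N -> gap_den (s q) (coord u (k q)) != 0) ->
  (fun w => \sum_(0 <= q < a) gap (s q) (coord w (k q))) @ u -->
  \sum_(0 <= q < a) gap (s q) (coord u (k q)).
Proof.
move=> h; rewrite big_mkord; under eq_cvg do rewrite big_mkord.
apply: cvg_sumR => q.
apply: (@continuous_comp _ _ _ (coord^~ (k q)) (gap (s q))).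
  exact: coord_fun_continuous.
by apply: gap_continuous; exact: h.
Qed.

Lemma chain_continuous u p : finite_gaps u -> (p < n.+1)%N ->
  chain^~ p @ u --> chain u p.
Proof.
move=> [fy fx] pn; apply: (@cvg_mkC _ _ (nbhs u) (nbhs_filter u)).
  apply: (@cvgB _ R _ (nbhs u) (nbhs_filter u)).
    apply: (@sum_gap_continuous (fun=> true) (fun r => (n + r)%N)) => r rp.
    by apply: fx; have := col_lt pn; lia.
  apply: (@sum_gap_continuous (fun=> true) (fun r => (n + r)%N)) => r ri.
  by apply: fx; have := axis_lt; lia.
apply: (@cvgB _ R _ (nbhs u) (nbhs_filter u)).
  by apply: (@sum_gap_continuous same_col id) => q qp; apply: fy; lia.
apply: (@sum_gap_continuous same_col id) => q qo; apply: fy.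
by have := origin_lt; lia.
Qed.

Lemma bump_lt (k : 'I_n) : (bump origin_pos k < n.+1)%N.
Proof. by rewrite /bump; have := ltn_ord k; lia. Qed.

(** Consecutive points of a chain are the origin or points of the configuration,
    so a large gap forces a point of the configuration to be far away. *)
Lemma gap_sqr_le u (M : R) : 0 <= M ->
  (forall k, normsq (chain_row u ord0 k) <= M) ->
  (forall q, (q < n)%N -> ygap u q ^+ 2 <= 4 * M) /\
  (forall r, (r.+1 < size lam)%N -> xgap u r ^+ 2 <= 4 * M).
Proof.
move=> M0 h.
have bnd p : (p < n.+1)%N -> normsq (chain u p) <= M.
  move=> pn; have [->|po] := eqVneq p origin_pos.
    rewrite chain_origin; suff /eqP -> : normsq (0 : C R) == 0 by [].
    by rewrite normsq_eq0.
  have kn : (unbump origin_pos p < n)%N.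
    by rewrite /unbump; have := origin_lt; lia.
  by have := h (Ordinal kn); rewrite mxE /= unbumpK.
have re p : (p < n.+1)%N -> abscissa u (col p) ^+ 2 <= M.
  by move=> /bnd; apply: le_trans; rewrite /normsq lerDl sqr_ge0.
have im p : (p < n.+1)%N -> ordinate u p ^+ 2 <= M.
  by move=> /bnd; apply: le_trans; rewrite /normsq lerDr sqr_ge0.
have sub (a b : R) : a ^+ 2 <= M -> b ^+ 2 <= M -> (a - b) ^+ 2 <= 4 * M.
  by move=> ha hb; have := sqr_ge0 (a + b); nra.
split=> [q qn|r rl]; first by rewrite -ordinateS; apply: sub; apply: im; lia.
have cl m : (m < size lam)%N -> abscissa u m ^+ 2 <= M.
  move=> ml; have m0 := part_gt0 ml.
  by have := re _ (flatten_index_lt ml m0); rewrite col_flatten_index.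
by rewrite -abscissaS; apply: sub; apply: cl; lia.
Qed.

Lemma cell_map_finite u : finite_gaps u -> cell_map u = conf_of (chain_row u).
Proof. by rewrite /cell_map; case: pselect. Qed.

(** Where the gaps are finite, the chain depends continuously on the
    coordinates.  Where a gap is infinite, nearby gaps are large, and some point
    of the configuration is far away. *)
Lemma cell_map_continuous : continuous cell_map.
Proof.
move=> u; have [fu|nfu] := pselect (finite_gaps u).
  rewrite /continuous_at cell_map_finite//.
  suff cv : (@conf_of R n \o chain_row) @ u --> conf_of (chain_row u).
    move=> U /cv; apply: (@filterS2 _ _ (nbhs_filter u) _ _ _ _ (near_finite_gaps fu)).
    by move=> w fw; rewrite /= cell_map_finite.
  apply: continuous_comp; last exact: conf_of_continuous.
  apply: cvg_row => k; apply: chain_continuous => //; exact: bump_lt.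
move=> U; rewrite {1}/cell_map; case: pselect => // ? nU.
have {}nU : nbhs (None : Conf_compactified R n) U by [].
have [M M0 hM] := conf_of_near_None nU.
suff : \forall w \near u, finite_gaps w ->
    ~ forall k, normsq (chain_row w ord0 k) <= M.
  apply: (@filterS _ _ (nbhs_filter u)) => w hw; rewrite /= /cell_map.
  case: pselect => [fw|?]; last exact: nbhs_singleton nU.
  have /existsNP[k hk] := hw fw.
  by apply: hM; exists k; rewrite ltNge; apply/negP.
have blow s k : gap_den s (coord u k) = 0 ->
    \forall w \near u, gap_den s (coord w k) != 0 -> 4 * M < gap s (coord w k) ^+ 2.
  by move=> /(gap_blowup (4 * M)); exact: coord_fun_continuous.
have [[q [qn /blow]]|ny] :=
    pselect (exists q, (q < n)%N /\ gap_den (same_col q) (coord u q) = 0).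
  apply: (@filterS _ _ (nbhs_filter u)) => w hw [fy _] /(gap_sqr_le (ltW M0))[gy _].
  by have := lt_le_trans (hw (fy _ qn)) (gy _ qn); rewrite ltxx.
have [[r [rl /blow]]|nx] :=
    pselect (exists r, (r.+1 < size lam)%N /\ gap_den true (coord u (n + r)) = 0).
  apply: (@filterS _ _ (nbhs_filter u)) => w hw [_ fx] /(gap_sqr_le (ltW M0))[_ gx].
  by have := lt_le_trans (hw (fx _ rl)) (gx _ rl); rewrite ltxx.
case: nfu; split=> [q qn|r rl]; apply/eqP => h.
  by apply: ny; exists q.
by apply: nx; exists r.
Qed.

Lemma good_chain u :
  ordered_config_set (Cstar R) (chain_row u) <-> uniq (mkseq (chain u) n.+1).
Proof. by rewrite good_uniq (perm_uniq (perm_chain u)). Qed.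

Lemma flatten_indexS m c : flatten_index lam m c.+1 = (flatten_index lam m c).+1.
Proof. exact: addnS. Qed.

Lemma chain_layoutP (r : rel R) u :
  (forall m, (m.+1 < size lam)%N -> r (abscissa u m) (abscissa u m.+1)) ->
  (forall q, (q < n)%N -> same_col q -> 0 < ygap u q) ->
  layout r (lam, i, j) (chain_layout u).
Proof.
move=> hx hy.
have sorted_col m : (m < size lam)%N -> sorted <%R
    (mkseq (fun c => ordinate u (flatten_index lam m c)) (nth 0%N lam m)).
  move=> ml; apply: sorted_mkseq => c cm; rewrite flatten_indexS -subr_gt0 ordinateS.
  have lt := flatten_index_lt ml cm; rewrite flatten_indexS in lt.
  apply: hy => //; rewrite /same_col -flatten_indexS.
  by rewrite !col_flatten_index// ltnW.
have ml := axis_lt; have jl := origin_off.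
pose ys := mkseq (fun c => ordinate u (flatten_index lam i.-1 c)) (nth 0%N lam i.-1).
have szi : size ys = nth 0%N lam i.-1 by rewrite size_mkseq.
have nthj : nth 0 ys j = 0 by rewrite nth_mkseq// /ordinate subrr.
split.
- rewrite /chain_layout /mkseq -map_comp -[RHS](mkseq_nth 0%N).
  by apply: eq_map => m; rewrite /= size_map size_iota.
- rewrite /chain_layout /mkseq -map_comp; exact: sorted_mkseq.
- apply/allP => c /mapP[m]; rewrite mem_iota => /andP[_ ml'] -> /=.
  exact: sorted_col.
exists ys; split.
- by rewrite nth_mkseq// /abscissa subrr.
- by rewrite -[X in X \in _]nthj mem_nth// szi.
by rewrite -[X in count (< X) _]nthj sorted_count_nth ?szi//; exact: sorted_col.
Qed.

(** On the closed cube a gap inside a column may vanish, but then two points of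
    the chain collide. *)
Lemma weak_chain_layout u : `|u| <= 1 ->
  ordered_config_set (Cstar R) (chain_row u) ->
  layout <=%R (lam, i, j) (chain_layout u).
Proof.
move=> u1 /good_chain uc; apply: chain_layoutP => [m ml|q qn sq].
  by rewrite -subr_ge0 abscissaS; apply: gap_ge0; exact: coord_le.
rewrite /ygap sq lt_neqAle gap_ge0 ?andbT; last exact: coord_le.
apply/eqP => g0; have := uc => /(uniqP 0)/(_ q q.+1); rewrite !inE size_mkseq.
rewrite !nth_mkseq ?ltnS// ?(ltnW qn)// => /(_ isT qn) h.
suff : q = q.+1 by lia.
apply: h; rewrite /chain (eqP sq); congr mkC.
by apply/eqP; rewrite eq_sym -subr_eq0 ordinateS /ygap sq -g0.
Qed.

Lemma strict_chain_layout u : `|u| < 1 -> layout <%R (lam, i, j) (chain_layout u).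
Proof.
move=> u1; apply: chain_layoutP => [m ml|q qn sq].
  by rewrite -subr_gt0 abscissaS; apply: gap_gt0; exact: coord_lt.
by rewrite /ygap sq; apply: gap_gt0; exact: coord_lt.
Qed.

Lemma chain_sorted u : `|u| < 1 -> sorted lexlt (mkseq (chain u) n.+1).
Proof.
move=> u1; apply: sorted_mkseq => p; rewrite ltnS => pn; rewrite /lexlt /chain /=.
have := col_mono (leqnSn p); rewrite leq_eqVlt => /predU1P[E|lt].
  rewrite E eqxx ltxx /= -subr_gt0 ordinateS /ygap /same_col E eqxx.
  by apply: gap_gt0; exact: coord_lt.
rewrite -subr_gt0 /abscissa opprB addrA subrK.
rewrite (big_cat_nat (n := col p) (p := col p.+1)) ?(ltnW lt)//= addrC addKr.
suff : 0 < \sum_(col p <= r < col p.+1) xgap u r by move=> ->.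
rewrite (big_ltn lt) ltr_pwDl//; first by apply: gap_gt0; exact: coord_lt.
by apply: sumr_ge0 => r _; apply/ltW/gap_gt0/coord_lt.
Qed.

Lemma finite_gaps_open u : `|u| < 1 -> finite_gaps u.
Proof. by move=> u1; split=> *; apply: gap_den_neq0; exact: coord_lt. Qed.

Lemma chain_good u : `|u| < 1 -> ordered_config_set (Cstar R) (chain_row u).
Proof.
move=> /chain_sorted h; apply/good_chain.
exact: sorted_uniq lexlt_trans lexlt_irr _ h.
Qed.

Lemma cell_map_some u : finite_gaps u ->
  ordered_config_set (Cstar R) (chain_row u) ->
  exists2 c : ordered_config (Cstar R) n, cell_map u = Some (config_class c) &
    set_val c = chain_row u.
Proof.
move=> fu gu; exists (ordered_of gu) => //.
by rewrite cell_map_finite// -conf_of_val.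
Qed.

Lemma cell_map_someP u q : cell_map u = Some q ->
  finite_gaps u /\ exists2 c : ordered_config (Cstar R) n, q = config_class c &
    set_val c = chain_row u.
Proof.
rewrite /cell_map; case: pselect => // fu /conf_of_some[c cu qc].
by split => //; exists c.
Qed.

Lemma eq_coord u v : (forall k, (k < d)%N -> coord u k = coord v k) -> u = v.
Proof. by move=> h; apply/rowP => a; rewrite -!coord_ord h. Qed.

Lemma coord_cases k : (k < d)%N ->
  (k < n)%N \/ exists2 r, k = (n + r)%N & (r.+1 < size lam)%N.
Proof.
rewrite /d => kd; have [kn|nk] := ltnP k n; first by left.
by right; exists (k - n)%N; lia.
Qed.

(** Inside the cube both chains are the sorted enumeration of the same
    configuration, and the coordinates are recovered from the gaps. *)
Lemma cell_map_inj u v : `|u| < 1 -> `|v| < 1 -> cell_map u = cell_map v -> u = v.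
Proof.
move=> u1 v1.
have [c -> cE] := cell_map_some (finite_gaps_open u1) (chain_good u1).
have [e -> eE] := cell_map_some (finite_gaps_open v1) (chain_good v1).
move=> [/config_class_perm]; rewrite cE eE => ce.
have chE : mkseq (chain u) n.+1 = mkseq (chain v) n.+1.
  apply: (irr_sorted_eq lexlt_trans lexlt_irr (chain_sorted u1) (chain_sorted v1)).
  apply: perm_mem; have := perm_chain u; rewrite perm_sym => /perm_trans; apply.
  by apply: perm_trans (perm_chain v); rewrite perm_cons.
have ch p : (p < n.+1)%N -> chain u p = chain v p.
  by move=> pn; have := congr1 (nth 0 ^~ p) chE; rewrite !nth_mkseq.
have im p : (p < n.+1)%N -> ordinate u p = ordinate v p.
  by move=> /ch/(congr1 (@imag_part R)).
have re m : (m < size lam)%N -> abscissa u m = abscissa v m.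
  move=> ml; have m0 := part_gt0 ml.
  have /(congr1 (@real_part R)) /= := ch _ (flatten_index_lt ml m0).
  by rewrite /chain col_flatten_index.
apply: eq_coord => k /coord_cases[kn|[r -> rl]].
  rewrite -(gapK (same_col k) (coord_lt k u1)) -(gapK (same_col k) (coord_lt k v1)).
  by congr gap_inv; rewrite -!/(ygap _ _) -!ordinateS !im// ltnW.
rewrite -(gapK true (coord_lt (n + r) u1)) -(gapK true (coord_lt (n + r) v1)).
by congr gap_inv; rewrite -!/(xgap _ _) -!abscissaS !re// ltnW.
Qed.

Lemma coord_val u k (kd : (k < d)%N) : coord u k = u ord0 (Ordinal kd).
Proof. by rewrite /coord insubT. Qed.

(** The gaps of the layout are read off and turned into coordinates; the sums that
    define the chain then telescope, up to the normalization at the origin. *)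
Lemma layout_chain (r : rel R) cols :
  subrel r <=%R -> layout r (lam, i, j) cols ->
  exists u, [/\ `|u| <= 1, finite_gaps u, chain_layout u = cols &
                subrel r <%R -> `|u| < 1].
Proof.
move=> rle [lamE sX sY [ys [nthi ys0 jE]]].
pose yss := map snd cols.
have shE : shape yss = lam by rewrite -lamE /shape -map_comp.
have szc : size cols = size lam by rewrite -lamE size_map.
pose Xt m := nth 0 (map fst cols) m; pose Yt p := nth 0 (flatten yss) p.
have colE m : (m < size lam)%N ->
    size (nth [::] yss m) = nth 0%N lam m /\ sorted <%R (nth [::] yss m).
  move=> ml; have mc : (m < size cols)%N by rewrite szc.
  split; first by rewrite -shE (nth_map [::]) ?size_map.
  rewrite (nth_map (0, [::]))//; apply: (allP sY); exact: mem_nth.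
have YtE p : Yt p = nth 0 (nth [::] yss (col p)) (reshape_offset lam p).
  by rewrite /Yt nth_flatten shE.
have Yflat m c : (c < nth 0 lam m)%N ->
    Yt (flatten_index lam m c) = nth 0 (nth [::] yss m) c.
  by move=> cm; rewrite YtE col_flatten_index// flatten_indexKr.
have hX m : (m.+1 < size lam)%N -> r (Xt m) (Xt m.+1).
  by move=> ml; move/(sortedP 0): sX; apply; rewrite size_map szc.
have hY q : (q < n)%N -> same_col q -> Yt q < Yt q.+1.
  move=> qn /eqP sq; have qs : (q.+1 < sumn lam)%N by rewrite sumn_parts.
  have [szq soq] := colE _ (col_lt (p := q.+1) qn).
  have oE : reshape_offset lam q.+1 = (reshape_offset lam q).+1.
    have := reshape_indexK lam q; have := reshape_indexK lam q.+1.
    rewrite -/(col q) -/(col q.+1) -sq /flatten_index; lia.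
  have := reshape_offsetP qs; rewrite -/(col _) => olt.
  rewrite oE -szq in olt; rewrite !YtE sq oE.
  by rewrite (lt_sorted_ltn_nth 0 soq) ?inE ?(ltnW olt).
have Xi : Xt i.-1 = 0 by rewrite /Xt (nth_map (0, [::])) ?szc ?nthi ?axis_lt.
have Yo : Yt origin_pos = 0.
  have ysE : nth [::] yss i.-1 = ys by rewrite (nth_map (0, [::])) ?szc ?axis_lt// nthi.
  rewrite (Yflat _ _ origin_off) ysE; have [_ ] := colE _ axis_lt; rewrite ysE => sy.
  have := sorted_count_nth sy (k := index 0 ys); rewrite index_mem nth_index// jE.
  by move=> /(_ ys0) ->; rewrite nth_index.
pose u : 'rV[R]_d := \row_k
  if (k < n)%N then gap_inv (same_col k) (Yt k.+1 - Yt k)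
  else gap_inv true (Xt (k - n).+1%N - Xt (k - n)%N).
have cy q : (q < n)%N -> coord u q = gap_inv (same_col q) (Yt q.+1 - Yt q).
  move=> qn; have qd : (q < d)%N by have := axis_lt; rewrite /d; lia.
  by rewrite (coord_val _ qd) mxE /= qn.
have cx m : (m.+1 < size lam)%N -> coord u (n + m) = gap_inv true (Xt m.+1 - Xt m).
  move=> ml; have md : (n + m < d)%N by rewrite /d; lia.
  by rewrite (coord_val _ md) mxE /= ltnNge leq_addr /= addKn.
have gy q : (q < n)%N -> same_col q -> 0 < Yt q.+1 - Yt q.
  by move=> qn sq; rewrite subr_gt0 hY.
have gx m : (m.+1 < size lam)%N -> 0 <= Xt m.+1 - Xt m.
  by move=> ml; rewrite subr_ge0 rle// hX.
have iy q (qn : (q < n)%N) := gap_invK (fun sq => ltW (gy q qn sq)).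
have ix m (ml : (m.+1 < size lam)%N) := gap_invK (s := true) (fun=> gx m ml).
have fu : finite_gaps u.
  split=> [q qn|m ml]; first by rewrite cy//; have [] := iy q qn.
  by rewrite cx//; have [] := ix m ml.
have ugy q : (q < n)%N -> ygap u q = Yt q.+1 - Yt q.
  by move=> qn; rewrite /ygap cy//; have [] := iy q qn.
have ugx m : (m.+1 < size lam)%N -> xgap u m = Xt m.+1 - Xt m.
  by move=> ml; rewrite /xgap cx//; have [] := ix m ml.
have oE p : (p < n.+1)%N -> ordinate u p = Yt p.
  move=> pn; rewrite /ordinate.
  have tele a : (a < n.+1)%N -> \sum_(0 <= q < a) ygap u q = Yt a - Yt 0%N.
    move=> an; rewrite -telescope_sumr//; apply: eq_big_nat => q /andP[_ qa].
    by rewrite ugy//; lia.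
  by rewrite !tele ?origin_lt// Yo; ring.
have aE m : (m < size lam)%N -> abscissa u m = Xt m.
  move=> ml; rewrite /abscissa.
  have tele a : (a < size lam)%N -> \sum_(0 <= q < a) xgap u q = Xt a - Xt 0%N.
    move=> al; rewrite -telescope_sumr//; apply: eq_big_nat => q /andP[_ qa].
    by rewrite ugx//; lia.
  by rewrite !tele ?axis_lt// Xi; ring.
exists u; split=> //.
- apply/mx_norm_leP => // k; rewrite -coord_ord.
  have [kn|[m -> ml]] := coord_cases (ltn_ord k).
    by rewrite cy//; apply: gap_inv_le1 => ?; exact/ltW/gy.
  by rewrite cx//; apply: gap_inv_le1 => ?; exact: gx.
- apply: (@eq_from_nth _ (0, [::])); first by rewrite size_mkseq szc.
  move=> m; rewrite size_mkseq => ml; rewrite nth_mkseq// aE//.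
  have [szm _] := colE _ ml.
  have -> : nth (0, [::]) cols m = (Xt m, nth [::] yss m).
    by rewrite /Xt !(nth_map (0, [::])) ?szc//; case: (nth _ _ _).
  congr (_, _); apply: (@eq_from_nth _ 0); rewrite size_mkseq ?szm// => k km.
  by rewrite nth_mkseq// oE ?flatten_index_lt// Yflat.
move=> rlt; apply/mx_norm_ltP => // k; rewrite -coord_ord.
have [kn|[m -> ml]] := coord_cases (ltn_ord k).
  by rewrite cy//; apply: gap_inv_lt1; exact: gy.
by rewrite cx//; apply: gap_inv_lt1 => _; rewrite subr_gt0 rlt// hX.
Qed.

Lemma cell_map_layout u (c : ordered_config (Cstar R) n) : finite_gaps u ->
  perm_eq (0 :: points (set_val c)) (layout_points (chain_layout u)) ->
  cell_map u = Some (config_class c).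
Proof.
move=> fu; rewrite layout_points_chain => pc.
have gu : ordered_config_set (Cstar R) (chain_row u).
  by apply/good_chain; rewrite -(perm_uniq pc); apply/good_uniq/good_val.
have [e -> eE] := cell_map_some fu gu; congr Some; apply/config_class_perm.
rewrite eE -(perm_cons 0); apply: perm_trans (perm_chain u) _.
by rewrite perm_sym.
Qed.

End Parametrization.

(** * The cells *)

Section Cells.
Context {R : realType} (n : nat).
Notation ordconf := (ordered_config (Cstar R) n).
Notation cell := (cell_set R n).

Lemma with_originE (c : ordconf) : points_with_origin c = 0 :: points (set_val c).
Proof. by []. Qed.

Lemma with_origin_uniq (c : ordconf) : uniq (points_with_origin c).
Proof. by rewrite with_originE; apply/good_uniq/good_val. Qed.

Lemma open_cellP t (c : ordconf) :
  open_cell R n t (config_class c) <-> triple_of (points_with_origin c) = t.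
Proof.
case: t => [[lam i] j]; split=> [[e [<- <- <-] /config_class_perm ec]|[? ? ?]].
  by apply: triple_of_perm; rewrite !with_originE perm_cons perm_sym.
by exists c.
Qed.

Lemma triple_of_points (c : ordconf) :
  is_cell_index n (triple_of (points_with_origin c)).
Proof.
apply: triple_of_index; rewrite with_originE ?inE ?eqxx//=.
by rewrite size_points.
Qed.

Lemma cell_SomeP (a : cell_index n) (c : ordconf) :
  cell (Some a) (Some (config_class c)) <->
  triple_of (points_with_origin c) = val a.
Proof.
rewrite -open_cellP; split=> [[q h [<-]]//|h]; by exists (config_class c).
Qed.

Lemma cell_None (a : cell_index n) : ~ cell (Some a) None.
Proof. by case. Qed.

Lemma opc_cases (x : Conf_compactified R n) :
  x = None \/ exists c : ordconf, x = Some (config_class c).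
Proof.
case: x => [q|]; [right|by left].
by have [c ->] := config_class_surj q; exists c.
Qed.

Lemma cells_cover : \bigcup_a cell a = setT.
Proof.
apply/seteqP; split=> // x _; have [->|[c ->]] := opc_cases x.
  by exists None.
exists (Some (exist (fun t => is_cell_index n t) _ (triple_of_points c))) => //.
by apply/cell_SomeP.
Qed.

Lemma cells_disjoint a b : cell a `&` cell b !=set0 -> a = b.
Proof.
move=> [x []]; have [->|[c ->]] := opc_cases x.
  by case: a => [a /cell_None//|_]; case: b => [b /cell_None|].
case: a => [a /cell_SomeP ha|//]; case: b => [b /cell_SomeP hb|//].
by congr Some; apply: val_inj; rewrite /= -ha -hb.
Qed.

(** An index is determined by a list of bounded length with bounded entries and by
    three bounded numbers. *)
Lemma finite_cells : finite_set [set: option (cell_index n)].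
Proof.
pose F : finType := ((n.+1.-tuple 'I_n.+2) * 'I_n.+2 * 'I_n.+2 * 'I_n.+2)%type.
pose g (x : F) : option (cell_index n) :=
  insub (take x.1.1.2 (map val x.1.1.1), val x.1.2, val x.2).
apply: (@sub_finite_set _ _ (g @` setT `|` [set None])); last first.
  by rewrite finite_setU; split; [exact/finite_image/finite_finset|exact: finite_set1].
move=> [[[[lam i] j] v]|] _; last by right.
left; have /and3P[/andP[pos /eqP sm] hi hj] := v.
have nthle k : (nth 0 lam k <= sumn lam)%N.
  elim: lam k {v pos sm hi hj} => [|p lam IH] [|k]//=; first exact: leq_addr.
  exact: leq_trans (IH k) (leq_addl _ _).
have szle : (size lam <= sumn lam)%N.
  elim: lam pos {v sm hi hj nthle} => //= p lam IH /andP[p0 /IH]; lia.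
have jle : (part lam i <= n.+1)%N by rewrite -sm; exact: nthle.
exists ([tuple inord (nth 0%N lam k) | k < n.+1], inord (size lam), inord i, inord j) => //.
rewrite /g /= !inordK; try lia.
rewrite (_ : take _ _ = lam); last first.
  rewrite -map_comp (eq_map (g := nth 0%N lam \o val)); last first.
    by move=> k /=; rewrite inordK//; have := nthle k; rewrite sm; lia.
  rewrite map_comp val_enum_ord -map_take take_iota (minn_idPl _) -?sm//.
  exact: mkseq_nth.
by rewrite insubT.
Qed.

(** Columns that share a vertical line count as one. *)
Lemma size_columns (s : seq (C R)) cols : all (fun c => 0 < size c.2)%N cols ->
  perm_eq s (layout_points cols) ->
  size (column_sizes s) = size (undup (map fst cols)).
Proof.
move=> pos sp; rewrite size_map; apply/perm_size/uniq_perm.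
- by have := columns_sorted s; rewrite lt_sorted_uniq_le => /andP[].
- exact: undup_uniq.
move=> x; rewrite mem_columns mem_undup -(real_part_layout pos).
by apply: perm_mem; exact: perm_map.
Qed.

Lemma layout_pos (r : rel R) lam i j cols : is_cell_index n (lam, i, j) ->
  layout r (lam, i, j) cols -> all (fun c => 0 < size c.2)%N cols.
Proof.
by move=> /and3P[/andP[pos _] _ _] [lamE _ _ _]; rewrite -lamE all_map in pos.
Qed.

Lemma cell_map_image (a : cell_index n) :
  @cell_map R n (val a).1.1 (val a).1.2 (val a).2 @` [set u | `|u| < 1] = cell (Some a).
Proof.
have cellP := cell_SomeP a; case: a cellP => [[[lam i] j] v].
rewrite [val _]/= => cellP; apply/seteqP; split.
  move=> _ [u /= u1 <-].
  have [c -> cE] := cell_map_some (finite_gaps_open u1) (chain_good v u1).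
  apply/cellP; rewrite with_originE cE.
  rewrite (triple_of_perm (perm_chain v u)) -(layout_points_chain v) /=.
  have /and3P[/andP[pos _] /andP[i0 _] _] := v.
  exact: strict_layout_triple (strict_chain_layout v u1).
move=> x; have [->|[c ->]] := opc_cases x; first by move/cell_None.
move=> /cellP tE.
have := layout_columns_of (with_origin_uniq c) (mem_head _ _); rewrite tE => lc.
have [u [_ fu uE u1]] := layout_chain v (fun x y => @ltW _ _ x y) lc.
exists u; first exact: u1.
by apply: (cell_map_layout v) => //; rewrite uE; exact: perm_columns_of.
Qed.

End Cells.

(** * Attaching maps and boundaries *)

Section Attaching.
Context {R : realType} (n : nat).
Hypothesis n_gt0 : (0 < n)%N.
Notation ordconf := (ordered_config (Cstar R) n).
Notation cell := (cell_set R n).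
Notation dim := (cell_dim n).

(** Some coordinate is 1 or -1.  If the gaps are finite, this is a vanishing gap:
    not between ordinates of the same column, as the points are distinct, hence
    between the abscissas of two neighbouring columns. *)
Lemma cell_map_sphere lam i j u (c : ordconf) :
  is_cell_index n (lam, i, j) -> `|u| = 1 ->
  @cell_map R n lam i j u = Some (config_class c) ->
  (size (column_sizes (points_with_origin c)) < size lam)%N.
Proof.
move=> v u1 /cell_map_someP[[fy fx] [e /config_class_perm ce eE]].
have ge : ordered_config_set (Cstar R) (chain_row i j u) by rewrite -eE; exact: good_val.
have uc : uniq (mkseq (chain i j u) n.+1) by apply/(good_chain v).
have lay : layout <=%R (lam, i, j) (chain_layout i j u).
  by apply: weak_chain_layout => //; rewrite u1.
have pc : perm_eq (points_with_origin c) (layout_points (chain_layout i j u)).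
  rewrite with_originE (layout_points_chain v); apply: perm_trans (perm_chain v u).
  by rewrite perm_cons -eE.
rewrite (size_columns (layout_pos v lay) pc).
have szX : size (map fst (chain_layout i j u)) = size lam by rewrite size_map size_mkseq.
rewrite -[ltnRHS]szX ltn_neqAle size_undup andbT.
suff nuX : ~~ uniq (map fst (chain_layout i j u)).
  apply: contra nuX => /eqP h; rewrite (uniq_size_uniq (undup_uniq _) (@mem_undup _ _)).
  by rewrite h.
have [k k1] : exists k, 1 <= `|u ord0 k|.
  apply: contrapT => nk; suff : `|u| < 1 by rewrite u1 ltxx.
  apply/mx_norm_ltP => // k; rewrite ltNge; apply/negP => h; apply: nk; by exists k.
have kle : `|u ord0 k| <= 1 by rewrite -[X in _ <= X]u1 mx_norm_coord.
have km1 : gap_den true (coord u k) != 0 -> coord u k = -1.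
  rewrite coord_ord /gap_den subr_eq0 eq_sym => h; move: k1 kle.
  rewrite ler_norml lerNl => + /andP[h1 h2].
  rewrite ler_normr => /orP[h3|h3]; last by lra.
  by case/eqP: h; lra.
have [kn|[r kr rl]] := coord_cases v (ltn_ord k).
  have := fy _ kn; case sk : (same_col lam k); last first.
    by rewrite coord_ord /gap_den subr_eq0 eq_le k1 kle.
  move=> /km1 ck; have := uc => /(uniqP 0)/(_ (nat_of_ord k) k.+1).
  rewrite !inE size_mkseq.
  rewrite !nth_mkseq ?ltnS ?(ltnW kn)// => /(_ isT kn) h.
  suff /n_Sn : nat_of_ord k = k.+1 by [].
  apply: h; rewrite /chain (eqP sk); congr mkC.
  apply/eqP; rewrite eq_sym -subr_eq0 ordinateS /ygap sk ck /gap /gap_num.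
  by rewrite subrr mul0r.
have := fx _ rl; rewrite -kr => /km1 ck; apply/negP => /(uniqP 0)/(_ r r.+1).
rewrite !inE szX (ltnW rl) rl => /(_ isT isT) h.
suff /n_Sn : r = r.+1 by [].
apply: h; rewrite /chain_layout /mkseq -map_comp !(nth_map 0%N) ?size_iota ?(ltnW rl)//.
rewrite !nth_iota ?(ltnW rl)//= !add0n.
apply/eqP; rewrite eq_sym -subr_eq0 abscissaS /xgap -kr ck /gap /gap_num.
by rewrite subrr mul0r.
Qed.

Lemma finite_indices (J : set (option (cell_index n))) : finite_set J.
Proof. exact: sub_finite_set (finite_cells n). Qed.

Lemma None_characteristic : exists Phi : 'rV[R]_(dim None) -> Conf_compactified R n,
  characteristic_map cell Phi.
Proof.
have x0 (u : 'rV[R]_0) : u = 0 by exact: thinmx0.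
exists (cst None \o @disk_to_cube R 0).
apply: (@characteristic_map_of_cube R (Conf_compactified R n) _ dim cell None).
- exact: compactified_hausdorff.
- exact: cells_disjoint.
- exact: cst_continuous.
- by move=> u w _ _ _; rewrite (x0 u) (x0 w).
- apply/seteqP; split=> [_ [u _ <-]//|_ ->].
  by exists 0 => //=; rewrite normr0.
exists set0; split=> // y [u /= + _]; rewrite (x0 u) normr0 => /esym/eqP.
by rewrite oner_eq0.
Qed.

Lemma Some_characteristic (a : cell_index n) :
  exists Phi : 'rV[R]_(dim (Some a)) -> Conf_compactified R n,
  characteristic_map cell Phi.
Proof.
have im := @cell_map_image R n a.
have sph lam i j (u : 'rV[R]_(n + size lam - 1)) c v := @cell_map_sphere lam i j u c v.
exists (cell_map (val a).1.2 (val a).2 \o @disk_to_cube R (dim (Some a))).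
apply: (@characteristic_map_of_cube R (Conf_compactified R n) _ dim cell (Some a)).
- exact: compactified_hausdorff.
- exact: cells_disjoint.
- case: a {im} => [[[lam i] j] v]; exact: cell_map_continuous v.
- case: a {im} => [[[lam i] j] v]; exact: cell_map_inj v.
- exact: im.
exists [set k | (dim k < dim (Some a))%N]; split=> //; first exact: finite_indices.
case: a {im} => [[[lam i] j] v] _ [u /= u1 <-].
have [->|[c cE]] := opc_cases (cell_map i j u).
  by exists None => //=; have /and3P[_ /andP[? ?] _] := v; lia.
rewrite cE; exists (Some (exist (fun t => is_cell_index n t) _ (triple_of_points c))).
  have /= := sph _ _ _ _ _ v u1 cE; have /and3P[_ /andP[? ?] _] := v.
  by have /and3P[_ /andP[? ?] _] := triple_of_points c; lia.
by exists (config_class c) => //; apply/open_cellP.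
Qed.

Lemma compactification_is_CW : is_CW_complex R dim cell.
Proof.
split.
- exact: compactified_hausdorff.
- exact: cells_cover.
- exact: cells_disjoint.
- by case=> [a|]; [exact: Some_characteristic|exact: None_characteristic].
move=> A cA.
have -> : A = \bigcup_(a in [set: option (cell_index n)]) (A `&` closure (cell a)).
  apply/seteqP; split=> [x xA|x [a _ []//]].
  have [a _ xa] : (\bigcup_a cell a) x by rewrite cells_cover.
  by exists a => //; split=> //; exact: subset_closure.
by apply: closed_bigcup => *; [exact: finite_cells|exact: cA].
Qed.

(** The closure of a cell is the image of the closed cube: this image is compact,
    and it is contained in the closure by contraction of the cube.  Its finite
    points are the configurations of chains with nonnegative gaps between the
    abscissas. *)
Lemma closure_cellP (a : cell_index n) (c : ordconf) :
  closure (cell (Some a)) (Some (config_class c)) <->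
  exists2 cols, layout <=%R (val a) cols &
    perm_eq (points_with_origin c) (layout_points cols).
Proof.
rewrite -cell_map_image; case: a => [[[lam i] j] v]; rewrite [val _]/=.
split=> [|[cols lc pc]]; last first.
  have [u [u1 fu uE _]] := layout_chain v (fun x y h => h) lc.
  rewrite -(cell_map_layout v fu (c := c)); last by rewrite uE.
  by apply: cube_closure => //; exact: cell_map_continuous v.
set K := [set u : 'rV[R]_(n + size lam - 1) | `|u| <= 1].
have cK : compact K.
  apply: bounded_closed_compact.
    by exists 1; split; rewrite ?num_real// => M M1 x /= /le_trans; apply; exact: ltW.
  apply: (@preimage_closed _ _ (fun x : 'rV[R]_(n + size lam - 1) => `|x|)
    [set t : R | t <= 1]).
    by move=> x _; exact: norm_continuous.
  exact: closed_le.
have cim : closed (cell_map i j @` K : set (Conf_compactified R n)).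
  apply: compact_closed; first exact: compactified_hausdorff.
  apply: continuous_compact => //.
  by apply: continuous_subspaceT; exact: cell_map_continuous v.
move=> /(closureS (B := cell_map i j @` K)) h.
have [u uK] : (cell_map i j @` K) (Some (config_class c)).
  rewrite ((closure_id _).1 cim); apply: h => _ [u /= u1 <-]; exists u => //.
  exact: ltW.
move=> /cell_map_someP[fu [e /config_class_perm ce eE]].
exists (chain_layout i j u).
  apply: weak_chain_layout => //; rewrite -eE; exact: good_val.
rewrite with_originE (layout_points_chain v); apply: perm_trans (perm_chain v u).
by rewrite perm_cons -eE.
Qed.

(** Splitting the merged column gives a weak layout of the larger cell, whatever the
    configuration of the smaller one. *)
Lemma boundary_closure (a : cell_index n) t (c : ordconf) :
  boundary_form (val a) t -> triple_of (points_with_origin c) = t ->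
  closure (cell (Some a)) (Some (config_class c)).
Proof.
move=> bf tE; apply/closure_cellP; case: a bf => [[[lam i] j] v]; rewrite [val _]/= => bf.
have := layout_columns_of (with_origin_uniq c) (mem_head _ _); rewrite tE => lc.
have [cols lay pc] := split_layout v bf lc.
exists cols => //; apply: perm_trans (perm_columns_of _) _.
by rewrite perm_sym.
Qed.

Lemma dim_Some (a : cell_index n) : dim (Some a) = (n + (size (val a).1.1).-1)%N.
Proof.
by case: a => [[[lam i] j] v] /=; have /and3P[_ /andP[? ?] _] := v; lia.
Qed.

(** The number of columns drops by one, so the weak layout has a single coincidence
    of abscissas, and merging it gives the index of the smaller cell. *)
Lemma codim1_boundary_form (a b : cell_index n) :
  codim1_boundary_cell dim cell (Some a) (Some b) -> boundary_form (val a) (val b).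
Proof.
move=> [dE [x [[xa _]]]]; have [->|[c cE]] := opc_cases x; first by move/cell_None.
rewrite cE in xa * => /cell_SomeP cb; have [cols lay pc] := (closure_cellP a c).1 xa.
rewrite !dim_Some in dE; have bpos : (0 < size (val b).1.1)%N.
  by case: (b) => [[[lam i] j] v] /=; have /and3P[_ /andP[? ?] _] := v; lia.
case: a lay {xa} dE => [[[lam i] j] v]; rewrite [val _]/= => lay dE.
have upts : uniq (layout_points cols) by rewrite -(perm_uniq pc) with_origin_uniq.
have /and3P[_ hi _] := v.
have szE : size lam = (size (undup (map fst cols))).+1.
  rewrite -(size_columns (layout_pos v lay) pc).
  have -> : column_sizes (points_with_origin c) = (val b).1.1 by rewrite -cb.
  move: dE bpos => /=; move: hi; lia.
have [t [cols' [bf lay' pc']]] := merge_layout hi lay upts szE.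
suff -> : val b = t by [].
rewrite -cb (triple_of_perm (perm_trans pc pc')).
have [vt _] := boundary_form_index v bf.
case: t {bf} vt lay' => [[lam' i'] j'] /and3P[/andP[pos _] /andP[i0 _] _].
exact: strict_layout_triple.
Qed.

Lemma boundary_form_codim1 (a : cell_index n) t : boundary_form (val a) t ->
  exists b : cell_index n, val b = t /\
    codim1_boundary_cell dim cell (Some a) (Some b).
Proof.
move=> bf; have [vt szE] : is_cell_index n t /\ size (val a).1.1 = (size t.1.1).+1.
  exact: boundary_form_index (valP a) bf.
pose b : cell_index n := exist (fun t => is_cell_index n t) t vt.
have bE : val b = t by [].
have tpos : (0 < size t.1.1)%N.
  by move: (vt); case: (t) => [[lam i] j] /and3P[_ /andP[? ?] _] /=; lia.
exists b; split=> //; split; first by rewrite !dim_Some bE szE; lia.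
have [x] : cell (Some b) !=set0.
  by rewrite -cell_map_image; eexists; exists 0; [rewrite /mkset normr0|reflexivity].
have [->|[c ->]] := opc_cases x; first by move/cell_None.
move=> cb; exists (Some (config_class c)); split=> //.
move/cell_SomeP : cb => cb; split; first exact: boundary_closure bf cb.
by move/cell_SomeP => ca; move: szE; rewrite -ca cb bE; lia.
Qed.

End Attaching.

Theorem proposition4p1 (R : realType) (n : nat) (hn : (1 <= n)%N) :
  [/\ is_CW_complex R (cell_dim n) (cell_set R n),
      forall (a : cell_index n) (t : triple),
        boundary_form (val a) t <->
        exists b : cell_index n, val b = t /\
          codim1_boundary_cell (cell_dim n) (cell_set R n) (Some a) (Some b) &
      forall a b : cell_index n,
        codim1_boundary_cell (cell_dim n) (cell_set R n) (Some a) (Some b) ->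
        cell_set R n (Some b) `<=` closure (cell_set R n (Some a))].
Proof.
split.
- exact: compactification_is_CW.
- move=> a t; split; first exact: boundary_form_codim1.
  by move=> [b [<- /(codim1_boundary_form hn)]].
move=> a b /(codim1_boundary_form hn) bf x.
have [->|[c ->]] := opc_cases x; first by move/cell_None.
by move/cell_SomeP; exact: boundary_closure.
Qed.
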